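(* Let $1\leq p,q\leq\infty$, let $\phi$ be a weight, and let $\mu$ be a positive Borel measure on $(0,\infty)$. Then the Hausdorff operator $\mathcal{H}_\mu$ is bounded on $F_\phi^{p,q}$ if and only if $$\mu((0,1))=0 \quad\text{and}\quad \int_{(0,\infty)}\frac{1}{t}\,d\mu(t)<\infty.$$ In this case, its operator norm on $F_\phi^{p,q}$ is $$\|\mathcal{H}_\mu\|=\int_{[1,\infty)}\frac{1}{t}\,d\mu(t).$$
   Context: $H(\mathbb{C})$ denotes the space of entire functions. Let $\phi:[0,\infty)\to\mathbb{R}^+$ be continuously differentiable, extended radially to $\mathbb{C}$ by $\phi(z)=\phi(|z|)$. It is called a weight if $\int_0^\infty e^{-q\phi(r)}r\,dr<\infty$ for the exponent $q$ under consideration, $0<q<\infty$ (when the space considered has $q=\infty$, the integral condition is understood for some finite exponent). For $f\in H(\mathbb{C})$ and $0\le r<\infty$ let $M_p(f,r)=\left(\frac{1}{2\pi}\int_0^{2\pi}|f(re^{i\theta})|^p\,d\theta\right)^{1/p}$ for $0<p<\infty$ and $M_\infty(f,r)=\sup_{|z|=r}|f(z)|$. For $0<p\le\infty$, the weighted mixed norm Fock space $F_\phi^{p,q}$ consists of all $f\in H(\mathbb{C})$ with $\|f\|_{p,q,\phi}<\infty$, where $\|f\|_{p,q,\phi}^q=\int_0^\infty M_p^q(f,r)e^{-q\phi(r)}r\,dr$ if $0<q<\infty$, and $\|f\|_{p,\infty,\phi}=\sup_{r\in[0,\infty)}M_p(f,r)e^{-\phi(r)}$ if $q=\infty$. For $1\le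 p,q\le\infty$ it is a Banach space. For a positive Borel measure $\mu$ on $(0,\infty)$, the Hausdorff operator is defined formally by $\mathcal{H}_\mu f(z)=\int_{(0,\infty)}\frac{1}{t}f\left(\frac{z}{t}\right)d\mu(t)$, $z\in\mathbb{C}$, for $f\in H(\mathbb{C})$. Saying that $\mathcal{H}_\mu$ is bounded on $F_\phi^{p,q}$ means that this formula defines a bounded linear operator from $F_\phi^{p,q}$ to itself.
   Formalization: It is additionally assumed that all monomials z^n belong to F_φ^{p,q}; otherwise the space is a finite-dimensional space of polynomials and the equivalence fails, e.g. p=q=2, φ=1+log(1+r²), μ=δ_{1/2}. *)

(* Defs.v *)
From HB Require Import structures.
From mathcomp Require Import all_boot all_order all_algebra.
From mathcomp Require Import all_classical all_reals all_analysis.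
From mathcomp Require Import complex.

Set Implicit Arguments.
Unset Strict Implicit.
Unset Printing Implicit Defensive.

Import Order.TTheory GRing.Theory Num.Theory.
Import numFieldNormedType.Exports.

Local Open Scope classical_set_scope.
Local Open Scope ring_scope.
Local Open Scope complex_scope.

Section FockSpace.
Context {R : realType}.
Implicit Types (p q : \bar R) (phi : R -> R) (f g : R[i] -> R[i]) (r : R).

Local Notation leb := (@lebesgue_measure R).

(* Complex differentiability: [R[i]^o] is normed over the field [R[i]], so the
   difference quotient is taken along complex increments. *)
Definition entire f : Prop :=
  forall z : R[i], derivable (f : R[i]^o -> R[i]^o) z 1.

(* [dphi 0] is the right derivative at 0; the values of [phi] on the negative
   half-line are irrelevant. *)
Definition C1_halfline phi : Prop :=
  exists dphi : R -> R,
    {within `[0, +oo[, continuous dphi} /\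
    forall x : R, 0 <= x ->
      (phi y - phi x) / (y - x)
        @[y --> within `[0, +oo[ (dnbhs x)] --> dphi x.

Definition exp_integrable (s : R) phi : Prop :=
  (\int[leb]_(r in `[0%R, +oo[) (expR (- (s * phi r)) * r)%:E < +oo)%E.

Definition weight q phi : Prop :=
  [/\ C1_halfline phi,
      forall r, 0 <= r -> 0 <= phi r &
      match q with
      | EFin s => exp_integrable s phi
      | _ => exists2 s : R, 0 < s & exp_integrable s phi
      end].

Definition circle_point r (theta : R) : R[i] :=
  (r * cos theta) +i* (r * sin theta).

(* Exponents are extended reals in ]0, +oo]; the value at -oo is a dummy. *)
Definition Mmean p f r : \bar R :=
  match p with
  | EFin s =>
      (((2 * pi)^-1)%:E *
        \int[leb]_(theta in `[0%R, (2 * pi)%R])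
          ((Normc.normc (f (circle_point r theta))) `^ s)%:E) `^ s^-1
  | +oo => ereal_sup [set (Normc.normc (f z))%:E | z in [set z | Normc.normc z = r]]
  | -oo => 0
  end%E.

Definition Fock_norm p q phi f : \bar R :=
  match q with
  | EFin s =>
      (\int[leb]_(r in `[0%R, +oo[)
         ((Mmean p f r) `^ s * (expR (- (s * phi r)) * r)%:E)) `^ s^-1
  | +oo =>
      ereal_sup [set Mmean p f r * (expR (- phi r))%:E | r in `[0%R, +oo[]
  | -oo => 0
  end%E.

Definition Fock p q phi : set (R[i] -> R[i]) :=
  [set f | entire f /\ (Fock_norm p q phi f < +oo)%E].

(* A Borel measure on ]0, +oo[ is represented by a Borel measure on the line,
   only used through its values on subsets of ]0, +oo[. *)
Implicit Types mu : {measure set (measurableTypeR R) -> \bar R}.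

Definition Hausdorff_integrand f (z : R[i]) (t : R) : R[i] :=
  (t^-1)%:C * f (z / t%:C).

Definition Hausdorff_defined mu f : Prop :=
  forall z,
    mu.-integrable `]0%R, +oo[
      (fun t => (complex.Re (Hausdorff_integrand f z t))%:E) /\
    mu.-integrable `]0%R, +oo[
      (fun t => (complex.Im (Hausdorff_integrand f z t))%:E).

Definition Hausdorff mu f (z : R[i]) : R[i] :=
  (\int[mu]_(t in `]0%R, +oo[) complex.Re (Hausdorff_integrand f z t)) +i*
  (\int[mu]_(t in `]0%R, +oo[) complex.Im (Hausdorff_integrand f z t)).

Definition Hausdorff_bounded mu p q phi : Prop :=
  [/\ forall f, Fock p q phi f ->
        Hausdorff_defined mu f /\ Fock p q phi (Hausdorff mu f),
      forall (a : R[i]) f g, Fock p q phi f -> Fock p q phi g ->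
        forall z, Hausdorff mu (fun w => a * f w + g w) z =
                  a * Hausdorff mu f z + Hausdorff mu g z &
      exists C : R, forall f, Fock p q phi f ->
        (Fock_norm p q phi (Hausdorff mu f) <= C%:E * Fock_norm p q phi f)%E].

Definition Hausdorff_opnorm mu p q phi : \bar R :=
  ereal_sup [set Fock_norm p q phi (Hausdorff mu f) |
              f in [set f | Fock p q phi f /\ (Fock_norm p q phi f <= 1)%E]].

End FockSpace.

(* Main.v *)
Require Import Defs.
From HB Require Import structures.
From mathcomp Require Import all_boot all_order all_algebra.
From mathcomp Require Import all_classical all_reals all_analysis.
From mathcomp Require Import complex ring lra measurable_realfun.

Set Implicit Arguments.
Unset Strict Implicit.
Unset Printing Implicit Defensive.

Import Order.TTheory GRing.Theory Num.Theory.
Import numFieldNormedType.Exports.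

Local Open Scope classical_set_scope.
Local Open Scope ring_scope.

(** The operator acts on an entire function [f] by averaging its dilates [f (z / t)]
    against the weight [dmu(t) / t].

    Necessity. A monomial [z ^ n] is an eigenvector, with eigenvalue the moment of
    order [n], namely the integral of [t ^ - (n + 1)]. Boundedness bounds all moments
    by one constant. The moment of order 0 is the integral of [1 / t]; and a mass
    inside the unit interval would make the moments grow geometrically
    ([null_of_bounded_moments]).

    Sufficiency. Once [mu] lives on [t >= 1], every dilation involved is a contraction,
    and the means of an entire function over circles increase with the radius. The
    transform satisfies, at each radius separately,
      [Mmean p (Hausdorff mu f) r <= weight * Mmean p f r],
    where [weight] is the integral of [1 / t] ([circle_mean_Hausdorff] and
    [Hausdorff_circle_bound]); integrating in the radius bounds the operator norm by
    [weight] ([Fock_norm_Hausdorff]). Constants are multiplied by exactly [weight], so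
    the bound is attained.

    The inequality at a given radius is first proved for means over the vertices of
    regular polygons ([node_mean_Hausdorff]): Jensen's inequality for the weight
    exchanges the power with the integral over [t], a finite sum exchanges with that
    integral, and the resulting mean of [f] is a subharmonic function of the base
    point, to which the maximum principle applies. Letting the number of vertices grow
    gives the means over circles ([circle_mean_le]).

    This rests on the theory of functions that are complex differentiable at each point,
    whose derivative could a priori be discontinuous. Goursat's theorem on rectangles
    ([goursat]), read in exponential polar coordinates, gives the mean value property
    ([mean_value]), whence the subharmonicity of powers of the modulus
    ([submean_powR]) and the maximum principle ([maximum_principle]). Applied to
    difference quotients, the maximum principle yields locally uniform quadratic error
    bounds for the first-order expansion of an entire function ([entire_quadratic]),
    and these pass under the integral sign to show that the transform is entire
    ([Hausdorff_entire]). *)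

(** * The complex plane over the reals *)

Section ComplexPlane.
Context {R : realType}.
Local Open Scope complex_scope.
Local Notation C := R[i].
Local Notation normc := (@Normc.normc R).
Implicit Types (z w : C) (f : C -> C).

Lemma normC_normc z : `|z| = (normc z)%:C.
Proof. by []. Qed.

Lemma normc_ge0 z : 0 <= normc z.
Proof. by rewrite -ler0c -normC_normc. Qed.

Lemma normcB z w : normc (z - w) = normc (w - z).
Proof. by apply: (@complexI R); rewrite -!normC_normc distrC. Qed.

Lemma normc_eq0 z : (normc z == 0) = (z == 0).
Proof. by rewrite -(inj_eq (@complexI R)) -normC_normc normr_eq0. Qed.

Lemma normc_gt0 z : (0 < normc z) = (z != 0).
Proof. by rewrite lt_neqAle normc_ge0 andbT eq_sym normc_eq0. Qed.

Lemma cvgC_normc {T : Type} (F : set_system T) {FF : Filter F} (f : T -> C) (l : C) :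
  (f : T -> C^o) @ F --> (l : C^o) <->
  forall e : R, 0 < e -> \forall x \near F, normc (l - f x) < e.
Proof.
split.
  move/cvgrPdist_lt => h e e0; have e0' : 0 < e%:C by rewrite ltcR.
  by have := h _ e0'; apply: filterS => x; rewrite normC_normc ltcR.
move=> h; apply/cvgrPdist_lt => -[a b]; rewrite ltcE /= => /andP[/eqP -> a0].
by have := h _ a0; apply: filterS => x xa; rewrite normC_normc ltcE /= eqxx.
Qed.

Lemma nearC z (P : set C) :
  (\forall w \near (z : C^o), P w) <->
  exists2 e : R, 0 < e & forall w, normc (w - z) < e -> P w.
Proof.
split.
  move/nbhs_ballP => -[[a b]] /=; rewrite ltcE /= => /andP[/eqP -> a0] h.
  exists a => // w wz; apply: h; rewrite /ball/= -[X in X < _]/(`|z - w|).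
  by rewrite normC_normc normcB ltcE /= eqxx.
move=> [e e0 h]; apply/nbhs_ballP; exists e%:C; first by rewrite /= ltcR.
by move=> w; rewrite /ball/= normC_normc ltcR normcB; exact: h.
Qed.

Lemma normc_ge_Re z : `|complex.Re z| <= normc z.
Proof. by rewrite -lecR -normC_normc normc_ge_Re. Qed.

Lemma normc_ge_Im z : `|complex.Im z| <= normc z.
Proof.
case: z => a b /=; rewrite -sqrtr_sqr ler_wsqrtr //.
by rewrite lerDr sqr_ge0.
Qed.

Lemma normc_le z : normc z <= `|complex.Re z| + `|complex.Im z|.
Proof.
case: z => a b /=; rewrite -[leRHS]ger0_norm ?addr_ge0// -sqrtr_sqr ler_wsqrtr//.
rewrite sqrrD -2!normrX !(ger0_norm (sqr_ge0 _)).
by rewrite lerD2r lerDl mulrn_wge0// mulr_ge0.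
Qed.

Lemma normcD z w : normc (z + w) <= normc z + normc w.
Proof. by rewrite -lecR rmorphD/= -!normC_normc ler_normD. Qed.

Lemma normc_dist z w : `|normc z - normc w| <= normc (z - w).
Proof.
have h x y : normc x - normc y <= normc (x - y).
  by rewrite lerBlDr -{1}(subrK y x) normcD.
by rewrite ler_norml h andbT lerNl opprB normcB h.
Qed.

Lemma continuous_Re : continuous (@complex.Re R : C^o -> R).
Proof.
move=> z; apply/(@cvgrPdist_lt _ _ _ _ (nbhs_filter (z : C^o))) => e e0; apply/nearC; exists e => // w wz.
by rewrite (le_lt_trans _ wz)// normcB -raddfB normc_ge_Re.
Qed.

Lemma continuous_Im : continuous (@complex.Im R : C^o -> R).
Proof.
move=> z; apply/(@cvgrPdist_lt _ _ _ _ (nbhs_filter (z : C^o))) => e e0; apply/nearC; exists e => // w wz.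
by rewrite (le_lt_trans _ wz)// normcB -raddfB normc_ge_Im.
Qed.

Lemma continuous_normc : continuous (normc : C^o -> R).
Proof.
move=> z; apply/(@cvgrPdist_lt _ _ _ _ (nbhs_filter (z : C^o))) => e e0; apply/nearC; exists e => // w wz.
by rewrite (le_lt_trans (normc_dist _ _))// normcB.
Qed.

Lemma cvg_Complex {T : Type} (F : set_system T) {FF : Filter F} (u v : T -> R) a b :
  u @ F --> a -> v @ F --> b ->
  ((fun x => u x +i* v x) : T -> C^o) @ F --> (a +i* b : C^o).
Proof.
move=> /cvgrPdist_lt ua /cvgrPdist_lt vb; apply/cvgC_normc => e e0.
have e2 : 0 < e / 2 by rewrite divr_gt0.
apply: filterS2 (ua _ e2) (vb _ e2) => x ux vx.
by rewrite (le_lt_trans (normc_le _))//= [ltRHS]splitr ltrD.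
Qed.

(** The difference quotient, freed from its filters: only moduli remain. *)
Lemma derivableCP f z :
  derivable (f : C^o -> C^o) z 1 <->
  exists d : C, forall e : R, 0 < e -> exists2 del : R, 0 < del &
    forall h, normc h < del -> normc (f (z + h) - f z - d * h) <= e * normc h.
Proof.
split.
  move=> /cvg_ex[/= d fd]; exists d => e e0.
  have FF : Filter (dnbhs (0 : C^o)) by exact: within_filter.
  have := (@cvgC_normc C _ FF _ _).1 fd _ e0; rewrite near_withinE.
  move=> /((nearC _ _).1)[del del0 h].
  exists del => // k kd.
  have [->|k0] := eqVneq k 0; first by rewrite addr0 subrr mulr0 subrr Normc.normc0 mulr0.
  have := h k; rewrite subr0 => /(_ kd k0) /ltW.
  rewrite -(ler_pM2r (x := normc k)) ?normc_gt0// normcB -Normc.normcM.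
  rewrite (_ : (_ - d) * k = f (z + k) - f z - d * k)// mulrBl; congr (_ - _).
  by rewrite /= /GRing.scale/= mulr1 addrC (addrC k) mulrC mulrA mulfV// mul1r addrC.
move=> [d h]; apply/cvg_ex; have FF : Filter (dnbhs (0 : C^o)) by exact: within_filter.
exists d; apply: (@cvgC_normc C _ FF _ _).2 => e e0.
have [del del0 hd] := h (e / 2) (divr_gt0 e0 (ltr0Sn _ 1)); rewrite near_withinE; apply/nearC.
exists del => // k; rewrite subr0 => kd k0.
rewrite normcB -(ltr_pM2r (x := normc k)) ?normc_gt0// -Normc.normcM.
rewrite (_ : (_ - d) * k = f (z + k) - f z - d * k); last first.
  rewrite mulrBl; congr (_ - _).
  by rewrite /= /GRing.scale/= mulr1 addrC (addrC k) mulrC mulrA mulfV// mul1r addrC.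
apply: le_lt_trans (hd _ kd) _; rewrite ltr_pM2r ?normc_gt0// ltr_pdivrMr//.
by rewrite ltr_pMr// ltr1n.
Qed.

Lemma entire_continuous f : entire f -> continuous (f : C^o -> C^o).
Proof. by move=> ef z; apply/differentiable_continuous/derivable1_diffP/ef. Qed.

End ComplexPlane.

(** * Goursat's theorem on rectangles *)

Section Goursat.
Context {R : realType}.
Implicit Types (u v U V W : R -> R -> R).

Lemma normr_le_MVT (f df : R -> R) (a b K : R) : a <= b ->
  (forall x, a <= x <= b -> is_derive x 1 f (df x)) ->
  (forall x, a <= x <= b -> `|df x| <= K) ->
  `|f b - f a| <= K * (b - a).
Proof.
move=> ab fd dK.
have [x||c] := @MVT_segment R f df a b ab.
- by rewrite in_itv/= => /andP[ac cb]; apply: fd; rewrite !ltW.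
- apply: derivable_within_continuous => x; rewrite in_itv/= => xab.
  by have [] := fd _ xab.
by rewrite in_itv/= => cab ->; rewrite normrM (ger0_norm (x := b - a)) ?subr_ge0// ler_wpM2r ?subr_ge0// dK.
Qed.

(** When [W x] is a primitive of [w x], this is the difference of the integrals of [w]
    over two opposite sides of a rectangle. Written this way, contour integrals are
    additive under subdivision by mere algebra. *)
Definition mixed_diff W x1 x2 y1 y2 := W x2 y2 - W x2 y1 - (W x1 y2 - W x1 y1).

(** Total differentiability, with partial derivatives [a] and [b]. *)
Definition frechet2 u (x0 y0 a b : R) := forall e : R, 0 < e ->
  exists2 del : R, 0 < del & forall x y, `|x - x0| <= del -> `|y - y0| <= del ->
    `|u x y - u x0 y0 - a * (x - x0) - b * (y - y0)| <=
      e * (`|x - x0| + `|y - y0|).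

(** Were [P] to fail on a rectangle, it would fail on one of its quarters, hence on a
    nested sequence of quarters shrinking to a point, near which [P] holds. Quartering
    preserves the proportions of the rectangle. *)
Lemma rectangle_bisection (P : R -> R -> R -> R -> Prop) X1 X2 Y1 Y2 :
  X1 <= X2 -> Y1 <= Y2 ->
  (forall x1 x2 y1 y2, let m := (x1 + x2) / 2 in let n := (y1 + y2) / 2 in
    P x1 m y1 n -> P m x2 y1 n -> P x1 m n y2 -> P m x2 n y2 ->
    P x1 x2 y1 y2) ->
  (forall x0 y0, X1 <= x0 <= X2 -> Y1 <= y0 <= Y2 ->
    exists2 del : R, 0 < del & forall x1 x2 y1 y2 : R,
      X1 <= x1 <= x0 -> x0 <= x2 <= X2 -> Y1 <= y1 <= y0 -> y0 <= y2 <= Y2 ->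
      x2 - x1 <= del -> y2 - y1 <= del -> P x1 x2 y1 y2) ->
  P X1 X2 Y1 Y2.
Proof.
move=> X12 Y12 Psplit Ploc; apply: contrapT => nP.
pose Q (r : R * R * R * R) := ~ P r.1.1.1 r.1.1.2 r.1.2 r.2.
pose half (r s : R * R * R * R) :=
  [/\ r.1.1.1 <= s.1.1.1, s.1.1.2 <= r.1.1.2, r.1.2 <= s.1.2 & s.2 <= r.2] /\
  (s.1.1.2 - s.1.1.1 = (r.1.1.2 - r.1.1.1) / 2 /\ s.2 - s.1.2 = (r.2 - r.1.2) / 2).
pose T := {r : R * R * R * R | Q r /\ (r.1.1.1 <= r.1.1.2 /\ r.1.2 <= r.2)}.
have next (r : T) : {s : T | half (projT1 r) (projT1 s)}.
  case: r => -[[[x1 x2] y1] y2] [/= nr [x12 y12]]; apply: cid.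
  have /= := Psplit x1 x2 y1 y2.
  set m := (x1 + x2) / 2; set n := (y1 + y2) / 2 => sp.
  have x1m : x1 <= m by rewrite /m; lra.
  have mx2 : m <= x2 by rewrite /m; lra.
  have y1n : y1 <= n by rewrite /n; lra.
  have ny2 : n <= y2 by rewrite /n; lra.
  have [p1|p1] := pselect (P x1 m y1 n); last first.
    exists (exist _ (x1, m, y1, n) (conj p1 (conj x1m y1n))).
    by split; [split => //=|rewrite /= /m /n; split; field].
  have [p2|p2] := pselect (P m x2 y1 n); last first.
    exists (exist _ (m, x2, y1, n) (conj p2 (conj mx2 y1n))).
    by split; [split => //=|rewrite /= /m /n; split; field].
  have [p3|p3] := pselect (P x1 m n y2); last first.
    exists (exist _ (x1, m, n, y2) (conj p3 (conj x1m ny2))).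
    by split; [split => //=|rewrite /= /m /n; split; field].
  have [p4|p4] := pselect (P m x2 n y2); last first.
    exists (exist _ (m, x2, n, y2) (conj p4 (conj mx2 ny2))).
    by split; [split => //=|rewrite /= /m /n; split; field].
  by exfalso; apply: nr; exact: sp.
pose r0 : T := exist _ (X1, X2, Y1, Y2) (conj nP (conj X12 Y12)).
pose r := fix r n : T := if n is k.+1 then projT1 (next (r k)) else r0.
have rS n : half (projT1 (r n)) (projT1 (r n.+1)) by exact: (projT2 (next (r n))).
pose a n := (projT1 (r n)).1.1.1; pose b n := (projT1 (r n)).1.1.2.
pose c n := (projT1 (r n)).1.2; pose d n := (projT1 (r n)).2.
have ab n : a n <= b n by have := projT2 (r n); case=> _ [].
have cd n : c n <= d n by have := projT2 (r n); case=> _ [].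
have mono n k : [/\ a n <= a (n + k)%N, b (n + k)%N <= b n, c n <= c (n + k)%N & d (n + k)%N <= d n].
  elim: k => [|k [IH1 IH2 IH3 IH4]]; first by rewrite addn0.
  rewrite addnS; have [[h1 h2 h3 h4] _] := rS (n + k)%N.
  by split; [exact: le_trans IH1 h1|exact: le_trans h2 IH2|exact: le_trans IH3 h3|exact: le_trans h4 IH4].
have anbm n m : a n <= b m.
  have [h1 _ _ _] := mono n m; have [_ h2 _ _] := mono m n.
  by rewrite (le_trans h1)// (le_trans (ab _))// addnC.
have cndm n m : c n <= d m.
  have [_ _ h1 _] := mono n m; have [_ _ _ h2] := mono m n.
  by rewrite (le_trans h1)// (le_trans (cd _))// addnC.
have wid n : b n - a n = (X2 - X1) / 2 ^+ n /\ d n - c n = (Y2 - Y1) / 2 ^+ n.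
  elim: n => [|n [IH1 IH2]]; first by rewrite expr0 !divr1.
  have [_ [h1 h2]] := rS n; rewrite /b /a /d /c h1 h2.
  rewrite -[X in X / 2 = _]/(b n - a n) -[X in _ /\ X / 2 = _]/(d n - c n) IH1 IH2.
  by rewrite exprSr invfM !mulrA.
pose x0 := sup (range a); pose y0 := sup (range c).
have a0 n : a n <= x0.
  by apply: ub_le_sup; [exists (b 0%N) => _ [m _ <-]|exists n].
have b0 n : x0 <= b n.
  by apply: ge_sup; [exists (a 0%N), 0%N|move=> _ [m _ <-]].
have c0 n : c n <= y0.
  by apply: ub_le_sup; [exists (d 0%N) => _ [m _ <-]|exists n].
have d0 n : y0 <= d n.
  by apply: ge_sup; [exists (c 0%N), 0%N|move=> _ [m _ <-]].
have [||del del0 hdel] := Ploc x0 y0; [by rewrite (a0 0%N) (b0 0%N)|by rewrite (c0 0%N) (d0 0%N)|].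
have small (w : R) : 0 <= w -> \forall n \near \oo, w / 2 ^+ n <= del.
  move=> w0; have := @cvg_geometric R w 2^-1.
  rewrite ger0_norm ?invr_ge0// invf_lt1// ltr1n => /(_ isT) /cvgr0_norm_lt /(_ del del0).
  apply: filterS => n /ltW; rewrite /geometric/= exprVn ger0_norm//.
  by rewrite mulr_ge0// invr_ge0 exprn_ge0.
have X0 : 0 <= X2 - X1 by rewrite subr_ge0.
have Y0 : 0 <= Y2 - Y1 by rewrite subr_ge0.
have [n _ hn] := filterI (small _ X0) (small _ Y0).
have [h1 h2] := hn n (leqnn n).
have [nPn _] := projT2 (r n); apply: nPn.
have [m1 m2 m3 m4] := mono 0%N n; rewrite add0n in m1 m2 m3 m4.
have [w1 w2] := wid n.
by apply: hdel; rewrite -/(a n) -/(b n) -/(c n) -/(d n) ?a0 ?b0 ?c0 ?d0 ?andbT ?w1 ?w2//.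
Qed.

(** Both mixed differences are [a] times the area, up to an error controlled by the
    first-order expansions: the coefficients [b] and [c] disappear, because they
    contribute equally to the two sides being subtracted. *)
Lemma mixed_diff_local U V u v (x0 y0 a b c e : R) : 0 < e ->
  frechet2 u x0 y0 a b -> frechet2 v x0 y0 c a ->
  exists2 del : R, 0 < del & forall x1 x2 y1 y2 : R,
    (forall x y : R, x1 <= x <= x2 -> y1 <= y <= y2 -> is_derive y 1 (U x) (u x y)) ->
    (forall x y : R, x1 <= x <= x2 -> y1 <= y <= y2 ->
       is_derive x 1 (fun s => V s y) (v x y)) ->
    x1 <= x0 <= x2 -> y1 <= y0 <= y2 -> x2 - x1 <= del -> y2 - y1 <= del ->
    `|mixed_diff U x1 x2 y1 y2 - mixed_diff V x1 x2 y1 y2| <=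
      e * ((x2 - x1) ^+ 2 + (y2 - y1) ^+ 2).
Proof.
(* The two errors add up to at most three times the sum of the squared sides. *)
move=> e0 fu fv; have e3 : 0 < e / 3 by rewrite divr_gt0.
have [d1 d10 h1] := fu _ e3; have [d2 d20 h2] := fv _ e3.
exists (Num.min d1 d2); first by rewrite lt_min d10.
move=> x1 x2 y1 y2 Ud Vd /andP[x10 x02] /andP[y10 y02]; rewrite !le_min.
move=> /andP[w1 w2] /andP[k1 k2].
have x12 := le_trans x10 x02; have y12 := le_trans y10 y02.
pose w := x2 - x1; pose k := y2 - y1.
have near x : x1 <= x <= x2 -> `|x - x0| <= w.
  by move=> /andP[? ?]; rewrite /w ler_norml; apply/andP; split; lra.
have neary y : y1 <= y <= y2 -> `|y - y0| <= k.
  by move=> /andP[? ?]; rewrite /k ler_norml; apply/andP; split; lra.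
have x1i : x1 <= x1 <= x2 by rewrite lexx.
have x2i : x1 <= x2 <= x2 by rewrite lexx andbT.
have y1i : y1 <= y1 <= y2 by rewrite lexx.
have y2i : y1 <= y2 <= y2 by rewrite lexx andbT.
have sumx : `|x2 - x0| + `|x1 - x0| = w.
  by rewrite /w ger0_norm ?subr_ge0// ler0_norm ?subr_le0//; ring.
have sumy : `|y2 - y0| + `|y1 - y0| = k.
  by rewrite /k ger0_norm ?subr_ge0// ler0_norm ?subr_le0//; ring.
have bU : `|mixed_diff U x1 x2 y1 y2 - a * w * k| <= e / 3 * (w + 2 * k) * k.
  pose D y := U x2 y - U x1 y - a * w * y.
  have -> : mixed_diff U x1 x2 y1 y2 - a * w * k = D y2 - D y1.
    by rewrite /D /mixed_diff /w /k; ring.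
  apply: (@normr_le_MVT D (fun y => u x2 y - u x1 y - a * w)) => // y yi.
    rewrite /D; have ? := Ud _ _ x2i yi; have ? := Ud _ _ x1i yi.
    apply: is_deriveB; apply: is_derive_eq.
    by rewrite scaler1.
  have -> : u x2 y - u x1 y - a * w =
    (u x2 y - u x0 y0 - a * (x2 - x0) - b * (y - y0)) -
    (u x1 y - u x0 y0 - a * (x1 - x0) - b * (y - y0)) by rewrite /w; ring.
  have yk := neary _ yi.
  apply: le_trans (ler_normB _ _) _.
  apply: le_trans (lerD (h1 _ _ _ _) (h1 _ _ _ _)) _;
    rewrite ?(le_trans (near _ _) w1)// ?(le_trans (neary _ _) k1)//.
  rewrite -mulrDr ler_pM2l//; lra.
have bV : `|mixed_diff V x1 x2 y1 y2 - a * w * k| <= e / 3 * (k + 2 * w) * w.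
  pose D x := V x y2 - V x y1 - a * k * x.
  have -> : mixed_diff V x1 x2 y1 y2 - a * w * k = D x2 - D x1.
    by rewrite /D /mixed_diff /w /k; ring.
  apply: (@normr_le_MVT D (fun x => v x y2 - v x y1 - a * k)) => // x xi.
    rewrite /D; have ? := Vd _ _ xi y2i; have ? := Vd _ _ xi y1i.
    apply: is_deriveB; apply: is_derive_eq.
    by rewrite scaler1.
  have -> : v x y2 - v x y1 - a * k =
    (v x y2 - v x0 y0 - c * (x - x0) - a * (y2 - y0)) -
    (v x y1 - v x0 y0 - c * (x - x0) - a * (y1 - y0)) by rewrite /k; ring.
  have xw := near _ xi.
  apply: le_trans (ler_normB _ _) _.
  apply: le_trans (lerD (h2 _ _ _ _) (h2 _ _ _ _)) _;
    rewrite ?(le_trans (near _ _) w2)// ?(le_trans (neary _ _) k2)//.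
  rewrite -mulrDr ler_pM2l//; lra.
have -> : mixed_diff U x1 x2 y1 y2 - mixed_diff V x1 x2 y1 y2 =
  (mixed_diff U x1 x2 y1 y2 - a * w * k) - (mixed_diff V x1 x2 y1 y2 - a * w * k) by ring.
apply: le_trans (ler_normB _ _) _; apply: le_trans (lerD bU bV) _.
rewrite -/w -/k -subr_ge0.
have -> : e * (w ^+ 2 + k ^+ 2) - (e / 3 * (w + 2 * k) * k + e / 3 * (k + 2 * w) * w)
  = e / 3 * (w - k) ^+ 2 by field.
by rewrite mulr_ge0 ?sqr_ge0// ltW.
Qed.

(** For a complex differentiable [u + iv], whose partial derivatives satisfy
    [u_x = v_y], this is the vanishing of the imaginary part of a contour integral.
    The derivative may a priori be discontinuous, so integrals cannot be
    differentiated under the sign; instead, the bound by [e] times the sum of the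
    squared sides holds on small rectangles, and the bounds for four quarters add up
    to the bound for the whole. *)
Theorem goursat U V u v (X1 X2 Y1 Y2 : R) : X1 <= X2 -> Y1 <= Y2 ->
  (forall x y : R, X1 <= x <= X2 -> Y1 <= y <= Y2 -> is_derive y 1 (U x) (u x y)) ->
  (forall x y : R, X1 <= x <= X2 -> Y1 <= y <= Y2 ->
     is_derive x 1 (fun s => V s y) (v x y)) ->
  (forall x y : R, X1 <= x <= X2 -> Y1 <= y <= Y2 ->
     exists a b c, frechet2 u x y a b /\ frechet2 v x y c a) ->
  mixed_diff U X1 X2 Y1 Y2 = mixed_diff V X1 X2 Y1 Y2.
Proof.
move=> X12 Y12 Ud Vd fr; apply/eqP; rewrite -subr_eq0 -normr_le0.
pose A := (X2 - X1) ^+ 2 + (Y2 - Y1) ^+ 2.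
have A0 : 0 <= A by rewrite addr_ge0 ?sqr_ge0.
suff h e : 0 < e -> `|mixed_diff U X1 X2 Y1 Y2 - mixed_diff V X1 X2 Y1 Y2| <= e * A.
  apply/ler_addgt0Pr => e e0; rewrite add0r.
  have A1 : 0 < A + 1 by rewrite ltr_pwDr.
  apply: le_trans (h (e / (A + 1)) (divr_gt0 e0 A1)) _.
  by rewrite mulrAC ler_pdivrMr// ler_pM2l// lerDl.
move=> e0; rewrite /A.
apply: (@rectangle_bisection (fun x1 x2 y1 y2 => `|mixed_diff U x1 x2 y1 y2 - mixed_diff V x1 x2 y1 y2|
  <= e * ((x2 - x1) ^+ 2 + (y2 - y1) ^+ 2))) => //.
  move=> x1 x2 y1 y2 m n h1 h2 h3 h4.
  have -> : mixed_diff U x1 x2 y1 y2 - mixed_diff V x1 x2 y1 y2 =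
    ((mixed_diff U x1 m y1 n - mixed_diff V x1 m y1 n) + (mixed_diff U m x2 y1 n - mixed_diff V m x2 y1 n)) +
    ((mixed_diff U x1 m n y2 - mixed_diff V x1 m n y2) + (mixed_diff U m x2 n y2 - mixed_diff V m x2 n y2)).
    by rewrite /mixed_diff; ring.
  apply: le_trans (ler_normD _ _) _.
  apply: le_trans (lerD (ler_normD _ _) (ler_normD _ _)) _.
  apply: le_trans (lerD (lerD h1 h2) (lerD h3 h4)) _.
  by rewrite -subr_ge0 le_eqVlt; apply/orP; left; rewrite /m /n; apply/eqP; field.
move=> x0 y0 xi yi; have [a [b [c [fu fv]]]] := fr _ _ xi yi.
have [del del0 hd] := @mixed_diff_local U V u v x0 y0 a b c e e0 fu fv.
exists del => // x1 x2 y1 y2 /andP[? ?] /andP[? ?] /andP[? ?] /andP[? ?] ? ?.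
apply: hd => //; try (by apply/andP; split).
  by move=> x y /andP[? ?] /andP[? ?]; apply: Ud; apply/andP; split; lra.
by move=> x y /andP[? ?] /andP[? ?]; apply: Vd; apply/andP; split; lra.
Qed.

End Goursat.

(** * First-order expansions in two real variables *)

Section FrechetCalculus.
Context {R : realType}.
Local Open Scope complex_scope.
Local Notation C := R[i].
Local Notation normc := (@Normc.normc R).

Lemma is_derive_approx (p : R -> R) (x0 p' e : R) : is_derive x0 1 p p' -> 0 < e ->
  exists2 del : R, 0 < del & forall x, `|x - x0| <= del ->
    `|p x - p x0 - p' * (x - x0)| <= e * `|x - x0|.
Proof.
case=> pd pv e0; move: (pd) => /cvg_ex[/= l pl].
have {pv}lp : l = p' by rewrite -pv /derive; apply/esym; exact: cvg_lim pl.
move: pl => /cvgrPdist_lt /(_ _ e0); rewrite lp => /nbhs_ballP[del/= del0 h].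
exists (del / 2); first by rewrite divr_gt0.
move=> x xd; have [->|xx] := eqVneq x x0; first by rewrite !subrr mulr0 subr0 normr0 mulr0.
have kn0 : x - x0 != 0 by rewrite subr_eq0.
have := h (x - x0); rewrite /ball/= sub0r normrN => /(_ _ kn0) hx.
have {}hx : `|p' - (x - x0)^-1 *: (p ((x - x0) *: 1 + x0) - p x0)| < e.
  apply: hx; rewrite (le_lt_trans xd)// ltr_pdivrMr// ltr_pMr// ltr1n//.
rewrite -(@ler_pM2l _ `|x - x0|^-1) ?invr_gt0 ?normr_gt0//.
rewrite mulrCA mulVf ?normr_eq0// mulr1 -normfV -normrM distrC in hx *.
rewrite distrC in hx.
rewrite (_ : _ * _ = (x - x0)^-1 *: (p ((x - x0) *: 1 + x0) - p x0) - p') ?ltW//.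
  by rewrite distrC.
by rewrite /GRing.scale/= mulr1 subrK [LHS]mulrBr; congr (_ - _); rewrite mulrCA mulVf ?mulr1.
Qed.

(** Covers the coordinates [exp x * cos y] and [exp x * sin y]. *)
Lemma frechet2_mul (p q : R -> R) (x0 y0 p' q' : R) :
  is_derive x0 1 p p' -> is_derive y0 1 q q' ->
  frechet2 (fun x y => p x * q y) x0 y0 (p' * q y0) (p x0 * q').
Proof.
move=> dp dq e e0.
pose K := 1 + `|q y0| + `|p x0| + `|p'| + `|q'|.
have K0 : 0 < K by rewrite /K !ltr_wpDr.
have e1 : 0 < e / (3 * K) by rewrite divr_gt0// mulr_gt0.
have [d1 d10 h1] := is_derive_approx dp e1.
have [d2 d20 h2] := is_derive_approx dq e1.
have [d3 d30 h3] := is_derive_approx dq ltr01.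
have [d4 d40 [d41 d42]] : exists2 d4, 0 < d4 & d4 <= 1 /\ d4 <= e / (3 * K * (K + 1)).
  exists (Num.min 1 (e / (3 * K * (K + 1)))); last by rewrite !ge_min !lexx orbT.
  have K3 : 0 < 3 * K by rewrite mulr_gt0.
  by rewrite lt_min ltr01 (divr_gt0 e0 (mulr_gt0 K3 (addr_gt0 K0 ltr01))).
exists (Num.min (Num.min d1 d2) (Num.min d3 d4)); first by rewrite !lt_min d10 d20 d30.
move=> x y; rewrite !le_min => /andP[/andP[xd1 xd2] /andP[xd3 xd4]].
move=> /andP[/andP[yd1 yd2] /andP[yd3 yd']].
have yd4 := le_trans yd' d41; have yd5 := le_trans yd' d42.
set dx := x - x0 in xd1 xd2 xd3 xd4 *; set dy := y - y0 in yd1 yd2 yd3 yd' yd4 yd5 *.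
have {}h1 := h1 x xd1; have {}h2 := h2 y yd2; have {}h3 := h3 y yd3.
rewrite -/dx in h1; rewrite -/dy in h2 h3.
have -> : p x * q y - p x0 * q y0 - p' * q y0 * dx - p x0 * q' * dy =
  (p x - p x0 - p' * dx) * q y + p' * dx * (q y - q y0) + p x0 * (q y - q y0 - q' * dy).
  by ring.
have qd : `|q y - q y0| <= K * `|dy|.
  have -> : q y - q y0 = (q y - q y0 - q' * dy) + q' * dy by ring.
  apply: le_trans (ler_normD _ _) _; rewrite normrM mul1r in h3 *.
  apply: le_trans (lerD h3 (lexx _)) _; rewrite -{1}[`|dy|]mul1r -mulrDl ler_wpM2r//.
  by rewrite /K; have := normr_ge0 (q y0); have := normr_ge0 (p x0); have := normr_ge0 p'; lra.
have qb : `|q y| <= K + K.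
  have -> : q y = (q y - q y0) + q y0 by ring.
  apply: le_trans (ler_normD _ _) _; apply: lerD.
    by apply: le_trans qd _; rewrite ler_piMr// ltW.
  by rewrite /K; have := normr_ge0 q'; have := normr_ge0 (p x0); have := normr_ge0 p'; lra.
have pK : `|p x0| <= K.
  by rewrite /K; have := normr_ge0 q'; have := normr_ge0 (q y0); have := normr_ge0 p'; lra.
have p'K : `|p'| <= K.
  by rewrite /K; have := normr_ge0 q'; have := normr_ge0 (q y0); have := normr_ge0 (p x0); lra.
have t1 : `|(p x - p x0 - p' * dx) * q y| <= e * 2 / 3 * `|dx|.
  rewrite normrM; apply: le_trans (ler_pM _ _ h1 qb) _ => //.
  rewrite le_eqVlt; apply/orP; left; apply/eqP; field.
  by rewrite gt_eqF.
have t3 : `|p x0 * (q y - q y0 - q' * dy)| <= e / 3 * `|dy|.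
  rewrite normrM; apply: le_trans (ler_pM _ _ pK h2) _ => //.
  rewrite le_eqVlt; apply/orP; left; apply/eqP; field.
  by rewrite gt_eqF.
have t2 : `|p' * dx * (q y - q y0)| <= e / 3 * `|dx|.
  rewrite !normrM mulrAC ler_wpM2r//.
  have qd2 : `|q y - q y0| <= K * (e / (3 * K * (K + 1))).
    by apply: le_trans qd _; rewrite ler_pM2l.
  apply: le_trans (ler_pM _ _ p'K qd2) _ => //.
  rewrite (_ : K * (K * _) = e / 3 * (K / (K + 1))); last first.
    by field; rewrite !gt_eqF// addr_gt0.
  have K1 : 0 < K + 1 by rewrite addr_gt0.
  by apply: ler_piMr; [rewrite divr_ge0// ltW|rewrite ler_pdivrMr// mul1r lerDl].
apply: le_trans (ler_normD _ _) _; apply: le_trans (lerD (ler_normD _ _) t3) _.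
apply: le_trans (lerD (lerD t1 t2) (lexx _)) _; rewrite mulrDr.
have := mulr_ge0 (ltW e0) (normr_ge0 dy); lra.
Qed.

Lemma frechet2_lin (u v : R -> R -> R) (x0 y0 a b a' b' k l : R) :
  frechet2 u x0 y0 a b -> frechet2 v x0 y0 a' b' ->
  frechet2 (fun x y => k * u x y + l * v x y) x0 y0 (k * a + l * a') (k * b + l * b').
Proof.
move=> fu fv e e0; pose K := 1 + `|k| + `|l|.
have K0 : 0 < K by rewrite /K !ltr_wpDr.
have e1 : 0 < e / (2 * K) by rewrite divr_gt0// mulr_gt0.
have [d1 d10 h1] := fu _ e1; have [d2 d20 h2] := fv _ e1.
exists (Num.min d1 d2); first by rewrite lt_min d10.
move=> x y; rewrite !le_min => /andP[xd1 xd2] /andP[yd1 yd2].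
have {}h1 := h1 x y xd1 yd1; have {}h2 := h2 x y xd2 yd2.
set S := `|x - x0| + `|y - y0| in h1 h2 *.
have -> : k * u x y + l * v x y - (k * u x0 y0 + l * v x0 y0) -
    (k * a + l * a') * (x - x0) - (k * b + l * b') * (y - y0) =
  k * (u x y - u x0 y0 - a * (x - x0) - b * (y - y0)) +
  l * (v x y - v x0 y0 - a' * (x - x0) - b' * (y - y0)) by ring.
have kK : `|k| <= K by rewrite /K; have := normr_ge0 l; lra.
have lK : `|l| <= K by rewrite /K; have := normr_ge0 k; lra.
apply: le_trans (ler_normD _ _) _; rewrite !normrM.
apply: le_trans (lerD (ler_pM _ _ kK h1) (ler_pM _ _ lK h2)) _ => //.
by rewrite le_eqVlt; apply/orP; left; apply/eqP; field; rewrite gt_eqF.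
Qed.

Lemma frechet2_lip (u : R -> R -> R) (x0 y0 a b : R) : frechet2 u x0 y0 a b ->
  exists2 K : R, 0 < K & exists2 del : R, 0 < del & forall x y,
    `|x - x0| <= del -> `|y - y0| <= del ->
    `|u x y - u x0 y0| <= K * (`|x - x0| + `|y - y0|).
Proof.
move=> /(_ _ ltr01)[del del0 h]; exists (1 + `|a| + `|b|).
  by rewrite !ltr_wpDr.
exists del => // x y xd yd; have {}h := h x y xd yd.
set S := `|x - x0| + `|y - y0| in h *.
have -> : u x y - u x0 y0 = (u x y - u x0 y0 - a * (x - x0) - b * (y - y0)) +
  (a * (x - x0) + b * (y - y0)) by ring.
apply: le_trans (ler_normD _ _) _; rewrite -[1 + _ + _]addrA [leRHS]mulrDl; apply: lerD => //.
apply: le_trans (ler_normD _ _) _; rewrite !normrM mulrDl.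
by rewrite lerD// ler_wpM2l// /S ?lerDl ?lerDr.
Qed.

Lemma frechet2_perturb (u v : R -> R -> R) (x0 y0 a b : R) :
  frechet2 v x0 y0 a b ->
  (forall e, 0 < e -> exists2 del : R, 0 < del & forall x y,
     `|x - x0| <= del -> `|y - y0| <= del ->
     `|u x y - u x0 y0 - (v x y - v x0 y0)| <= e * (`|x - x0| + `|y - y0|)) ->
  frechet2 u x0 y0 a b.
Proof.
move=> fv uv e e0; have e2 : 0 < e / 2 by rewrite divr_gt0.
have [d1 d10 h1] := fv _ e2; have [d2 d20 h2] := uv _ e2.
exists (Num.min d1 d2); first by rewrite lt_min d10.
move=> x y; rewrite !le_min => /andP[xd1 xd2] /andP[yd1 yd2].
have {}h1 := h1 x y xd1 yd1; have {}h2 := h2 x y xd2 yd2.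
set S := `|x - x0| + `|y - y0| in h1 h2 *.
have -> : u x y - u x0 y0 - a * (x - x0) - b * (y - y0) =
  (u x y - u x0 y0 - (v x y - v x0 y0)) +
  (v x y - v x0 y0 - a * (x - x0) - b * (y - y0)) by ring.
by apply: le_trans (ler_normD _ _) _; apply: le_trans (lerD h2 h1) _; rewrite -mulrDl -splitr.
Qed.

(** The outer derivative acts as multiplication by a complex number [d]; this is where
    the Cauchy-Riemann equations come from. *)
Lemma frechet2_comp (F : C -> C) (c : C) (P Q : R -> R -> R) (x0 y0 a b a' b' : R) :
  derivable (F : C^o -> C^o) (c + (P x0 y0 +i* Q x0 y0)) 1 ->
  frechet2 P x0 y0 a b -> frechet2 Q x0 y0 a' b' ->
  exists d : C,
    frechet2 (fun x y => complex.Re (F (c + (P x y +i* Q x y)))) x0 y0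
      (complex.Re d * a - complex.Im d * a') (complex.Re d * b - complex.Im d * b') /\
    frechet2 (fun x y => complex.Im (F (c + (P x y +i* Q x y)))) x0 y0
      (complex.Im d * a + complex.Re d * a') (complex.Im d * b + complex.Re d * b').
Proof.
move=> /derivableCP[d hd] fP fQ; exists d.
have [K K0 [dK dK0 hK]] := frechet2_lip fP.
have [L L0 [dL dL0 hL]] := frechet2_lip fQ.
pose w x y := P x y +i* Q x y.
have key e : 0 < e -> exists2 del : R, 0 < del & forall x y,
     `|x - x0| <= del -> `|y - y0| <= del ->
     normc (F (c + w x y) - F (c + w x0 y0) - d * (w x y - w x0 y0)) <=
       e * (`|x - x0| + `|y - y0|).
  move=> e0; have KL0 : 0 < K + L by rewrite addr_gt0.
  have [d1 d10 h1] := hd _ (divr_gt0 e0 KL0).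
  pose d2 := d1 / (4 * (K + L)).
  have d20 : 0 < d2 by rewrite divr_gt0// mulr_gt0.
  exists (Num.min d2 (Num.min dK dL)); first by rewrite !lt_min d20 dK0.
  move=> x y; rewrite !le_min => /andP[xd1 /andP[xd2 xd3]] /andP[yd1 /andP[yd2 yd3]].
  have {}hK := hK x y xd2 yd2; have {}hL := hL x y xd3 yd3.
  set S := `|x - x0| + `|y - y0| in hK hL *.
  have wS : normc (w x y - w x0 y0) <= (K + L) * S.
    by apply: le_trans (normc_le _) _; rewrite mulrDl lerD.
  have := h1 (w x y - w x0 y0).
  rewrite (_ : _ + (w x y - w x0 y0) = c + w x y); last first.
    by rewrite -addrA; congr (c + _); rewrite addrC subrK.
  have wd1 : normc (w x y - w x0 y0) < d1.
    apply: le_lt_trans wS _; rewrite mulrC -ltr_pdivlMr//.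
    apply: le_lt_trans (lerD xd1 yd1) _.
    have -> : d2 + d2 = d1 / (K + L) / 2 by rewrite /d2; field; rewrite gt_eqF.
    by rewrite ltr_pdivrMr// ltr_pMr ?ltr1n// divr_gt0.
  move=> /(_ wd1) /le_trans; apply.
  by rewrite mulrAC ler_pdivrMr// -mulrA ler_pM2l// mulrC.
split.
  rewrite -mulNr -[X in frechet2 _ _ _ _ X]/(_ - _) -[complex.Re d * b - _]/(_ - _).
  apply: (@frechet2_perturb _ (fun x y => complex.Re d * P x y + (- complex.Im d) * Q x y)).
    by rewrite -[complex.Im d * b']opprK -mulNr opprK; exact: frechet2_lin.
  move=> e e0; have [del del0 h] := key _ e0; exists del => // x y xd yd.
  apply: le_trans (h x y xd yd); apply: le_trans (normc_ge_Re _).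
  rewrite !raddfB/= le_eqVlt; apply/orP; left; apply/eqP; congr (`| _ |).
  by rewrite /w; case: (d) => d1 d2 /=; ring.
apply: (@frechet2_perturb _ (fun x y => complex.Im d * P x y + complex.Re d * Q x y)).
  exact: frechet2_lin.
move=> e e0; have [del del0 h] := key _ e0; exists del => // x y xd yd.
apply: le_trans (h x y xd yd); apply: le_trans (normc_ge_Im _).
rewrite !raddfB/= le_eqVlt; apply/orP; left; apply/eqP; congr (`| _ |).
by rewrite /w; case: (d) => d1 d2 /=; ring.
Qed.

End FrechetCalculus.

(** * Circle averages and the mean value property *)

(** Locked, because unification would otherwise unfold it down to the Lebesgue
    integral at each rewriting step. *)
HB.lock Definition circle_avg (R : realType) (g : R -> R) : R :=
  (2 * pi)^-1 * \int[@lebesgue_measure R]_(t in `[0, 2 * pi]) g t.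
Arguments circle_avg {R} g.

Section MeanValue.
Context {R : realType}.
Local Open Scope complex_scope.
Local Notation C := R[i].
Local Notation normc := (@Normc.normc R).
Local Notation leb := (@lebesgue_measure R).
Implicit Types (z w c : C) (F : C -> C) (g : R -> R).

Lemma eq_ler (x y : R) : x = y -> x <= y.
Proof. by move=> ->. Qed.

Lemma continuous_funcomp (X S T : topologicalType) (f : X -> S) (h : S -> T) :
  continuous f -> continuous h -> continuous (fun x => h (f x)).
Proof. by move=> cf ch x; apply: continuous_comp; [exact: cf|exact: ch]. Qed.

Lemma continuous_funD (X : topologicalType) (f h : X -> R) :
  continuous f -> continuous h -> continuous (fun x => f x + h x).
Proof. by move=> cf ch x; apply: cvgD; [exact: cf|exact: ch]. Qed.

Lemma continuous_funZ (X : topologicalType) (k : R) (f : X -> R) :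
  continuous f -> continuous (fun x => k * f x).
Proof. by move=> cf x; apply: cvgM; [exact: cvg_cst|exact: cf]. Qed.

Lemma continuous_itv_integrable g (a b : R) : continuous g ->
  leb.-integrable `[a, b] (EFin \o g).
Proof.
move=> cg; apply: continuous_compact_integrable; first exact: segment_compact.
by apply: continuous_subspaceT => x; exact: cg.
Qed.

Lemma is_derive_Rintegral g (a y : R) : continuous g -> a < y ->
  is_derive y 1 (fun x => \int[leb]_(t in `[a, x]) g t) (g y).
Proof.
move=> cg ay; have yy : y < y + 1 by rewrite ltrDl.
have [h1 h2] := @continuous_FTC1_closed R g a y (y + 1) yy
  (continuous_itv_integrable _ _ cg) ay (cg y).
by rewrite -h2 derive1E; exact: (DeriveDef h1).
Qed.

Lemma RintegralB_itv g (a b x : R) : continuous g -> a <= x -> x <= b ->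
  \int[leb]_(t in `[a, b]) g t - \int[leb]_(t in `[a, x]) g t =
  \int[leb]_(t in `[x, b]) g t.
Proof.
move=> cg ax xb; rewrite Rintegral_itvB ?bnd_simp//; last exact: continuous_itv_integrable.
rewrite Rintegral_itv_obnd_cbnd//.
by apply: integrableS (continuous_itv_integrable x b cg) => //; exact: subset_itv_oc_cc.
Qed.

Lemma pi2_gt0 : 0 < 2 * pi :> R.
Proof. by rewrite mulr_gt0// pi_gt0. Qed.

Lemma normc_circle (r t : R) : normc (circle_point r t) = `|r|.
Proof. by rewrite /= !exprMn -mulrDr cos2Dsin2 mulr1 sqrtr_sqr. Qed.

Lemma circle_point2pi (r t : R) : circle_point r (t + 2 * pi) = circle_point r t.
Proof.
by rewrite /circle_point mulr_natl cosD2pi sinD2pi.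
Qed.

Lemma continuous_circle c (r : R) : continuous (fun t => c + circle_point r t : C^o).
Proof.
move=> t; apply: (@cvgD _ C^o); first exact: cvg_cst.
apply: cvg_Complex; apply: cvgM; try exact: cvg_cst.
  exact: continuous_cos.
exact: continuous_sin.
Qed.

Lemma continuous_expcircle c (t : R) : continuous (fun x => c + circle_point (expR x) t : C^o).
Proof.
move=> x; apply: (@cvgD _ C^o); first exact: cvg_cst.
by apply: cvg_Complex; apply: cvgM; try exact: cvg_cst; exact: continuous_expR.
Qed.

Lemma circle_avg_cst (k : R) : circle_avg (fun=> k) = k.
Proof.
rewrite circle_avg.unlock Rintegral_cst//= lebesgue_measure_itv/= lte_fin pi2_gt0/=.
by rewrite subr0 mulrCA mulVf ?mulr1// gt_eqF ?pi2_gt0.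
Qed.

Lemma le_circle_avg g1 g2 : continuous g1 -> continuous g2 ->
  (forall t, g1 t <= g2 t) -> circle_avg g1 <= circle_avg g2.
Proof.
move=> c1 c2 g12; rewrite circle_avg.unlock; apply: ler_wpM2l; first by rewrite invr_ge0 ltW// pi2_gt0.
by apply: le_Rintegral => //; exact: continuous_itv_integrable.
Qed.

Lemma circle_avgD g1 g2 : continuous g1 -> continuous g2 ->
  circle_avg (fun t => g1 t + g2 t) = circle_avg g1 + circle_avg g2.
Proof.
move=> c1 c2; rewrite circle_avg.unlock -mulrDr RintegralD//; exact: continuous_itv_integrable.
Qed.

Lemma circle_avgZ (k : R) g : continuous g ->
  circle_avg (fun t => k * g t) = k * circle_avg g.
Proof.
move=> c1; have ci := continuous_itv_integrable 0 (2 * pi) c1.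
by rewrite circle_avg.unlock (RintegralZl _ _ ci)// mulrCA.
Qed.

(** In the coordinates [exp (x + iy)] the function stays holomorphic and becomes
    periodic in [y]: the contributions of the sides [y = 0] and [y = 2 pi] of a
    rectangle cancel, so that those of two concentric circles agree. *)
Lemma circle_integral_const F c (r0 x1 x2 : R) : continuous (F : C^o -> C^o) ->
  (forall w, 0 < normc (w - c) < r0 -> derivable (F : C^o -> C^o) w 1) ->
  x1 <= x2 -> expR x2 < r0 ->
  circle_avg (fun t => complex.Re (F (c + circle_point (expR x1) t))) =
  circle_avg (fun t => complex.Re (F (c + circle_point (expR x2) t))).
Proof.
move=> cF dF x12 x2r.
pose u x y := complex.Re (F (c + circle_point (expR x) y)).
pose v x y := complex.Im (F (c + circle_point (expR x) y)).
have cu x : continuous (u x).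
  exact: continuous_funcomp (continuous_funcomp (@continuous_circle c _) cF) continuous_Re.
have cv y : continuous (v ^~ y).
  exact: continuous_funcomp (continuous_funcomp (@continuous_expcircle c _) cF) continuous_Im.
(* The base points lie outside the rectangle, to make the primitives differentiable
   on its whole boundary. *)
pose U x y := \int[leb]_(t in `[-1, y]) u x t.
pose V x y := \int[leb]_(s in `[x1 - 1, x]) v s y.
have pi0 : 0 <= 2 * pi :> R by rewrite ltW// pi2_gt0.
have mixed_diffE : mixed_diff U x1 x2 0 (2 * pi) = mixed_diff V x1 x2 0 (2 * pi).
  apply: (@goursat R U V u v) => //.
  - move=> x y _ /andP[y0 _]; apply: is_derive_Rintegral => //.
    by rewrite (lt_le_trans _ y0)// ltrN10.
  - move=> x y /andP[x0 _] _; apply: (is_derive_Rintegral (cv y)).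
    by rewrite (lt_le_trans _ x0)// ltrBlDr ltrDl.
  - move=> x y /andP[_ xx2] _.
    have fP : frechet2 (fun x y => expR x * cos y) x y (expR x * cos y) (expR x * (- sin y)).
      exact: frechet2_mul.
    have fQ : frechet2 (fun x y => expR x * sin y) x y (expR x * sin y) (expR x * cos y).
      exact: frechet2_mul.
    have [|d [h1 h2]] := @frechet2_comp R F c _ _ x y _ _ _ _ _ fP fQ.
      apply: dF; rewrite addrC addKr -/(circle_point _ _) normc_circle.
      by rewrite gtr0_norm ?expR_gt0//= (le_lt_trans _ x2r)// ler_expR.
    eexists; eexists; eexists; split; first exact: h1.
    have -> : complex.Re d * (expR x * cos y) - complex.Im d * (expR x * sin y) =
      complex.Im d * (expR x * - sin y) + complex.Re d * (expR x * cos y) by ring.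
    exact: h2.
have per x : V x (2 * pi) = V x 0.
  rewrite /V; congr Rintegral; apply/funext => s.
  by rewrite /v -[2 * pi]add0r circle_point2pi.
have bV : mixed_diff V x1 x2 0 (2 * pi) = 0.
  by rewrite /mixed_diff (per x1) (per x2); clear; lra.
have split x : U x (2 * pi) - U x 0 = \int[leb]_(t in `[0, 2 * pi]) u x t.
  by rewrite /U RintegralB_itv// lerN10.
rewrite circle_avg.unlock; apply: (congr1 (fun I => (2 * pi)^-1 * I)); apply: etrans (split x2).
apply: etrans (esym (split x1)) _; apply/esym/eqP; rewrite -subr_eq0; apply/eqP.
exact: etrans mixed_diffE bV.
Qed.

(** The average does not depend on the radius and tends to the central value.
    Differentiability is asked on a punctured disc, so that difference quotients
    qualify. *)
Lemma mean_value F c (r0 r : R) : continuous (F : C^o -> C^o) ->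
  (forall w, 0 < normc (w - c) < r0 -> derivable (F : C^o -> C^o) w 1) ->
  0 < r < r0 ->
  complex.Re (F c) = circle_avg (fun t => complex.Re (F (c + circle_point r t))).
Proof.
move=> cF dF /andP[r00 rr0]; pose u r t := complex.Re (F (c + circle_point r t)).
have cu s : continuous (u s).
  exact: continuous_funcomp (continuous_funcomp (@continuous_circle c _) cF) continuous_Re.
apply/eqP; rewrite -subr_eq0 -normr_le0; apply/ler_addgt0Pr => e e0; rewrite add0r.
have /cvgC_normc/(_ _ e0)/nearC[del del0 hd] := cF c.
pose s := Num.min r (del / 2).
have s0 : 0 < s by rewrite lt_min r00 divr_gt0.
have sd : s < del by rewrite gt_min ltr_pdivrMr// ltr_pMr// ltr1n orbT.
have sr : s <= r by rewrite ge_min lexx.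
have := @circle_integral_const F c r0 (ln s) (ln r) cF dF.
rewrite !lnK ?posrE// ler_ln ?posrE// => /(_ sr rr0) <-.
have bnd t : complex.Re (F c) - e <= u s t <= complex.Re (F c) + e.
  rewrite -ler_distl distrC -raddfB (le_trans (normc_ge_Re _))// ltW// hd//.
  by rewrite addrC addKr normc_circle gtr0_norm.
rewrite distrC ler_distl -{1}(circle_avg_cst (_ - _)) -(circle_avg_cst (_ + e)).
apply/andP; split; apply: le_circle_avg; try exact: cu; try exact: cst_continuous.
  by move=> t; have /andP[] := bnd t.
by move=> t; have /andP[] := bnd t.
Qed.

(** After rotating the values so that the central one is nonnegative, the mean
    value property only concerns real parts, and a real part is at most a modulus. *)
Lemma submean_normc F c (r0 r : R) : continuous (F : C^o -> C^o) ->
  (forall w, 0 < normc (w - c) < r0 -> derivable (F : C^o -> C^o) w 1) ->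
  0 < r < r0 ->
  normc (F c) <= circle_avg (fun t => normc (F (c + circle_point r t))).
Proof.
move=> cF dF rr0.
have cn : continuous (fun t => normc (F (c + circle_point r t))).
  exact: continuous_funcomp (continuous_funcomp (@continuous_circle c _) cF) continuous_normc.
have [Fc0|Fc0] := eqVneq (F c) 0.
  rewrite Fc0 Normc.normc0 -(circle_avg_cst 0).
  by apply: le_circle_avg => //; [exact: cst_continuous|move=> t; exact: normc_ge0].
pose k : C := `|F c| / F c.
have nk : normc k = 1.
  by apply: (@complexI R); rewrite -normC_normc normrM normr_id normfV mulfV// normr_eq0.
have kF : complex.Re (k * F c) = normc (F c).
  by rewrite /k mulrVK ?unitfE// normC_normc.
have ckF : continuous ((fun z => k * F z) : C^o -> C^o).
  exact: continuous_funcomp cF (@mulrl_continuous C k).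
have dkF w : 0 < normc (w - c) < r0 -> derivable ((fun z => k * F z) : C^o -> C^o) w 1.
  move=> /dF Fw; exact: (@derivableZ _ C^o C^o F k w 1 Fw).
rewrite -kF; apply: (le_trans (eq_ler (mean_value ckF dkF rr0))).
apply: le_circle_avg => //.
  exact: continuous_funcomp (continuous_funcomp (@continuous_circle c _) ckF) continuous_Re.
move=> t; apply: le_trans (ler_norm _) _; apply: le_trans (normc_ge_Re _) _.
by rewrite Normc.normcM nk mul1r.
Qed.

End MeanValue.

(** * Powers with real exponents *)

Section Powers.
Context {R : realType}.

Lemma continuous_powR_norm (s : R) : 0 < s -> continuous (fun x : R => `|x| `^ s).
Proof.
move=> s0 x; have [->|x0] := eqVneq x 0.
  apply/cvgrPdist_lt => e e0; rewrite normr0 powR0 ?gt_eqF//.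
  apply/nbhs_ballP; exists (e `^ s^-1); first exact: powR_gt0.
  move=> y; rewrite /ball/= !sub0r !normrN (ger0_norm (powR_ge0 _ _)) => ye.
  have := @gt0_ltr_powR _ s s0 `|y| (e `^ s^-1).
  rewrite -powRrM mulVf ?gt_eqF// powRr1 ?ltW//.
  by apply => //; rewrite nnegrE ?powR_ge0.
have nx : `|x| \in `]0, +oo[ by rewrite in_itv/= andbT normr_gt0.
have /derivable1_diffP/differentiable_continuous cp := @derivable_powR R 1 s _ nx.
exact: (cvg_comp (fun y : R => `|y|) (fun y : R => y `^ s) (@norm_continuous _ R^o x) cp).
Qed.

(** Convexity of the power, read off Young's inequality for conjugate exponents. *)
Lemma powR_tangent (s m x : R) : 1 <= s -> 0 <= m -> 0 <= x ->
  m `^ s + s * m `^ (s - 1) * (x - m) <= x `^ s.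
Proof.
rewrite le_eqVlt => /predU1P[<-|s1] m0 x0.
  by rewrite subrr powRr0 mul1r !powRr1// mul1r addrC subrK.
have s0 : 0 < s by rewrite (lt_trans _ s1).
have sB : 0 < s - 1 by rewrite subr_gt0.
have q0 : 0 < s / (s - 1) by rewrite divr_gt0.
have := @conjugate_powR R x (m `^ (s - 1)) s (s / (s - 1)) x0 (powR_ge0 _ _) s0 q0.
have -> : s^-1 + (s / (s - 1))^-1 = 1 by field; rewrite !gt_eqF.
move=> /(_ erefl); rewrite -powRrM (_ : (s - 1) * (s / (s - 1)) = s); last first.
  by field; rewrite gt_eqF.
rewrite -(ler_pM2l s0) => h.
have mm : m * m `^ (s - 1) = m `^ s by rewrite mulr_powRB1.
have E : s * (x `^ s / s + m `^ s / (s / (s - 1))) = x `^ s + (s - 1) * m `^ s.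
  by field; rewrite !gt_eqF.
rewrite E in h.
have -> : m `^ s + s * m `^ (s - 1) * (x - m) =
  m `^ s + s * (x * m `^ (s - 1)) - s * (m * m `^ (s - 1)) by ring.
rewrite mm; lra.
Qed.

End Powers.

(** * Subharmonic functions and the maximum principle *)

Section MaximumPrinciple.
Context {R : realType}.
Local Open Scope complex_scope.
Local Notation C := R[i].
Local Notation normc := (@Normc.normc R).
Implicit Types (z w c : C) (F f : C -> C) (U V : C -> R).

Lemma circle_point_surj z : exists2 t : R, `|t| <= pi & z = circle_point (normc z) t.
Proof.
have [->|z0] := eqVneq z 0.
  by exists 0; rewrite ?normr0 ?pi_ge0// /circle_point Normc.normc0 !mul0r.
case: z z0 => a b z0; set r := normc _.
have r0 : 0 < r by rewrite normc_gt0.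
have rn : r != 0 by rewrite gt_eqF.
have r2 : r ^+ 2 = a ^+ 2 + b ^+ 2 by rewrite /r /= sqr_sqrtr// addr_ge0 ?sqr_ge0.
have ar : -1 <= a / r <= 1.
  by rewrite -ler_norml normrM normfV (gtr0_norm r0) ler_pdivrMr// mul1r (normc_ge_Re (a +i* b)).
have cE : r * cos (acos (a / r)) = a by rewrite acosK ?in_itv//= mulrC divfK.
have sE : r * sin (acos (a / r)) = `|b|.
  rewrite sin_acos// -[X in X * _](gtr0_norm r0) -sqrtr_sqr -sqrtrM ?sqr_ge0//.
  rewrite (_ : r ^+ 2 * _ = b ^+ 2) ?sqrtr_sqr//.
  by rewrite mulrBr mulr1 -exprMn mulrCA mulfV// mulr1 r2 addrC addKr.
have bnd : `|acos (a / r)| <= pi by rewrite ger0_norm ?acos_lepi ?acos_ge0.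
have [b0|b0] := leP 0 b.
  by exists (acos (a / r)) => //; rewrite /circle_point cE sE ger0_norm.
by exists (- acos (a / r)); rewrite ?normrN// /circle_point cosN sinN mulrN cE sE ltr0_norm// opprK.
Qed.

Definition cdisc (r : R) : set C^o := [set z | normc z <= r].

Lemma compact_cdisc r : compact (cdisc r).
Proof.
pose q : R * R -> C^o := fun p => p.1 +i* p.2.
have cq : continuous q by move=> p; apply: cvg_Complex; [exact: cvg_fst|exact: cvg_snd].
apply: (@subclosed_compact _ _ (q @` (`[- r, r] `*` `[- r, r]))).
- rewrite (_ : cdisc r = normc @^-1` [set x | x <= r])//.
  by apply: closed_comp; [move=> z _; exact: continuous_normc|exact: closed_le].
- apply: continuous_compact; first exact: continuous_subspaceT.
  by apply: compact_setX; exact: segment_compact.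
- move=> [a b] zr; exists (a, b) => //; split => /=; rewrite in_itv/= -ler_norml.
    exact: le_trans (normc_ge_Re (a +i* b)) zr.
  exact: le_trans (normc_ge_Im (a +i* b)) zr.
Qed.

Lemma cdisc_max U r : 0 <= r -> continuous (U : C^o -> R) ->
  exists2 c, normc c <= r & forall z, normc z <= r -> U z <= U c.
Proof.
move=> r0 cU; have d0 : cdisc r !=set0 by exists (0 : C); rewrite /cdisc /mkset Normc.normc0.
have [|c cr h] := @compact_EVT_max C^o R U _ d0 (@compact_cdisc r).
  exact: continuous_subspaceT.
by exists c; [move: cr; rewrite inE|move=> z zr; apply: h; rewrite inE].
Qed.

(** Subharmonicity, tested on small circles only; how small may depend on the
    centre. *)
Definition submean U := continuous (U : C^o -> R) /\
  forall c, exists2 r0 : R, 0 < r0 &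
    forall r, 0 < r < r0 -> U c <= circle_avg (fun t => U (c + circle_point r t)).

Lemma continuous_on_circle U c r : continuous (U : C^o -> R) ->
  continuous (fun t => U (c + circle_point r t)).
Proof. by move=> cU; exact: continuous_funcomp (@continuous_circle R c r) cU. Qed.

Lemma submean_sum N (U : nat -> C -> R) : (forall k, submean (U k)) ->
  submean (fun z => \sum_(k < N) U k z).
Proof.
move=> sU; elim: N => [|N [c1 h1]].
  have -> : (fun z => \sum_(k < 0) U k z) = (fun=> 0).
    by apply/funext => z; rewrite big_ord0.
  split; first exact: cst_continuous.
  by move=> c; exists 1 => // r _; rewrite circle_avg_cst.
have -> : (fun z => \sum_(k < N.+1) U k z) = (fun z => \sum_(k < N) U k z + U N z).
  by apply/funext => z; rewrite big_ord_recr.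
have [c2 h2] := sU N; split; first exact: continuous_funD c1 c2.
move=> c; have [r1 r10 {}h1] := h1 c; have [r2 r20 {}h2] := h2 c.
exists (Num.min r1 r2); first by rewrite lt_min r10.
move=> r /andP[r0]; rewrite lt_min => /andP[rr1 rr2].
have {}h1 := h1 r; have {}h2 := h2 r; rewrite r0 rr1 in h1; rewrite r0 rr2 in h2.
apply: le_trans (lerD (h1 isT) (h2 isT)) _.
exact/eq_ler/esym/(circle_avgD (@continuous_on_circle _ c r c1) (@continuous_on_circle _ c r c2)).
Qed.

Lemma submeanZ (k : R) U : 0 <= k -> submean U -> submean (fun z => k * U z).
Proof.
move=> k0 [cU h]; split; first exact: continuous_funZ cU.
move=> c; have [r0 r00 {}h] := h c; exists r0 => // r rr.
apply: le_trans (ler_wpM2l k0 (h r rr)) _.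
exact/eq_ler/esym/(circle_avgZ _ (@continuous_on_circle _ c r cU)).
Qed.

Lemma continuous_powR_normc f (s : R) : 0 < s -> continuous (f : C^o -> C^o) ->
  continuous (fun z : C^o => normc (f z) `^ s).
Proof.
move=> s0 cf.
have -> : (fun z : C^o => normc (f z) `^ s) = (fun z : C^o => `|normc (f z)| `^ s).
  by apply/funext => z; rewrite ger0_norm ?normc_ge0.
exact: continuous_funcomp (continuous_funcomp cf (@continuous_normc R)) (continuous_powR_norm s0).
Qed.

(** Jensen on circles, by integrating the tangent line at the average. *)
Lemma submean_powR F (s : R) : 1 <= s -> continuous (F : C^o -> C^o) ->
  (forall c, exists2 r0 : R, 0 < r0 &
     forall w, 0 < normc (w - c) < r0 -> derivable (F : C^o -> C^o) w 1) ->
  submean (fun z => normc (F z) `^ s).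
Proof.
move=> s1 cF dF; have s0 : 0 < s by rewrite (lt_le_trans _ s1).
have cn : continuous (fun z : C^o => normc (F z)) := continuous_funcomp cF (@continuous_normc R).
have cU := continuous_powR_normc s0 cF.
split => // c; have [r0 r00 h] := dF c; exists r0 => // r rr.
have sm := submean_normc cF h rr.
have cg := @continuous_on_circle _ c r cn; have cgs := @continuous_on_circle _ c r cU.
set g := fun t => _ in sm cg; set m := circle_avg g in sm.
have m0 : 0 <= m by apply: le_trans sm; exact: normc_ge0.
have tan t : m `^ s + s * m `^ (s - 1) * (- m) + s * m `^ (s - 1) * g t <= (g t) `^ s.
  apply: le_trans (powR_tangent s1 m0 (normc_ge0 _)); apply/eq_ler.
  by rewrite /g; ring.
have k1c : continuous (fun _ : R => m `^ s + s * m `^ (s - 1) * (- m)).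
  exact: cst_continuous.
have k2c := @continuous_funZ _ _ (s * m `^ (s - 1)) _ cg.
have k12c := continuous_funD k1c k2c.
have := le_circle_avg k12c cgs tan.
rewrite (circle_avgD k1c k2c) circle_avg_cst (circle_avgZ _ cg) -/m.
apply: le_trans; rewrite mulrN addrNK.
by apply: (@ge0_ler_powR _ s (ltW s0)); rewrite ?nnegrE ?normc_ge0.
Qed.

Lemma submean_normcT F : continuous (F : C^o -> C^o) ->
  (forall c, exists2 r0 : R, 0 < r0 &
     forall w, 0 < normc (w - c) < r0 -> derivable (F : C^o -> C^o) w 1) ->
  submean (fun z => normc (F z)).
Proof.
move=> cF dF; have -> : (fun z => normc (F z)) = (fun z => normc (F z) `^ 1).
  by apply/funext => z; rewrite powRr1 ?normc_ge0.
exact: submean_powR (lexx _) cF dF.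
Qed.

(** The cross term is the real part of a holomorphic function of the variable point,
    so its circle averages are known. *)
Lemma sqr_normc_expand c h : normc (c + h) ^+ 2 =
  2 * complex.Re (c^*%C * (c + h)) - normc c ^+ 2 + normc h ^+ 2.
Proof.
case: c => a b; case: h => x y /=.
rewrite !sqr_sqrtr ?addr_ge0 ?sqr_ge0//; ring.
Qed.

(** Adding a small multiple of the squared modulus makes the sub-mean value
    inequality strict, which rules out an interior maximum. *)
Lemma maximum_principle U (r M : R) : submean U ->
  (forall w, normc w = r -> U w <= M) -> forall z, normc z <= r -> U z <= M.
Proof.
move=> [cU sU] UM z zr; have r0 : 0 <= r := le_trans (normc_ge0 z) zr.
suff h e : 0 < e -> U z <= M + e * r ^+ 2.
  apply/ler_addgt0Pr => e e0; have R0 : 0 < 1 + r ^+ 2 by rewrite ltr_pwDl// sqr_ge0.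
  apply: le_trans (h (e / (1 + r ^+ 2)) (divr_gt0 e0 R0)) _; rewrite lerD2l mulrAC.
  by rewrite ler_pdivrMr// ler_pM2l// lerDr.
move=> e0; pose V w := U w + e * normc w ^+ 2.
have cq : continuous (fun w : C^o => e * normc w ^+ 2).
  exact: continuous_funZ (continuous_funcomp (@continuous_normc R) (@exprn_continuous R 2)).
have cV : continuous (V : C^o -> R) := continuous_funD cU cq.
have [c cr Vc] := cdisc_max r0 cV.
have [crE|crN] := eqVneq (normc c) r.
  have := Vc _ zr; rewrite /V => h1.
  have h2 : 0 <= e * normc z ^+ 2 by rewrite mulr_ge0 ?sqr_ge0// ltW.
  have := UM _ crE; rewrite crE in h1; lra.
have {crN}crl : normc c < r by rewrite lt_neqAle crN.
have [r1 r10 hc] := sU c.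
pose s := Num.min (r1 / 2) (r - normc c).
have s0 : 0 < s by rewrite lt_min divr_gt0//= subr_gt0.
have sr1 : s < r1 by rewrite gt_min ltr_pdivrMr// ltr_pMr// ltr1n.
have sr : s <= r - normc c by rewrite ge_min lexx orbT.
have {}hc := hc s; rewrite s0 sr1 in hc.
pose L t := 2 * e * complex.Re (c^*%C * (c + circle_point s t)).
have cF : continuous (fun w : C^o => c^*%C * w : C^o) by exact: mulrl_continuous.
have cRe : continuous (fun t => complex.Re (c^*%C * (c + circle_point s t))).
  exact: continuous_funcomp (continuous_funcomp (@continuous_circle R c s) cF) (@continuous_Re R).
have dF w : 0 < normc (w - c) < s + 1 -> derivable ((fun w => c^*%C * w) : C^o -> C^o) w 1.
  by move=> _; apply: (@derivableZ _ C^o C^o id c^*%C w 1); exact: derivable_id.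
have ss : 0 < s < s + 1 by rewrite s0 ltrDl ltr01.
have mv := mean_value cF dF ss.
have Vb t : U (c + circle_point s t) + L t <= V c + e * normc c ^+ 2 - e * s ^+ 2.
  have := Vc (c + circle_point s t); rewrite {1}/V sqr_normc_expand normc_circle (gtr0_norm s0).
  rewrite /L; set X := complex.Re _ => hh.
  suff : normc (c + circle_point s t) <= r by move=> /hh; lra.
  by apply: le_trans (normcD _ _) _; rewrite normc_circle gtr0_norm//; lra.
have cL : continuous L := continuous_funZ cRe.
have cUc := @continuous_on_circle _ c s cU.
have cUL := continuous_funD cUc cL.
have := le_circle_avg cUL (@cst_continuous _ _ _) Vb.
rewrite (circle_avgD cUc cL) circle_avg_cst (circle_avgZ _ cRe) -mv.
have -> : complex.Re (c^*%C * c) = normc c ^+ 2.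
  case: (c) => a b /=; rewrite sqr_sqrtr ?addr_ge0 ?sqr_ge0//; ring.
have := hc isT; rewrite {1}/V => h1 h2.
have e2 : 0 < e * s ^+ 2 by rewrite mulr_gt0// exprn_gt0.
by exfalso; lra.
Qed.

End MaximumPrinciple.

(** * Quadratic error bounds for entire functions *)

Section DifferenceQuotients.
Context {R : realType}.
Local Open Scope complex_scope.
Local Notation C := R[i].
Local Notation normc := (@Normc.normc R).
Implicit Types (z w c a h : C) (f : C -> C).

Lemma entire_bounded f (rho : R) : entire f ->
  exists2 M : R, 0 <= M & forall w, normc w <= rho -> normc (f w) <= M.
Proof.
move=> /entire_continuous cf; have [r0|r0] := leP 0 rho; last first.
  by exists 0 => // w /(le_trans (normc_ge0 w)); rewrite leNgt r0.
have [c _ h] := cdisc_max r0 (continuous_funcomp cf (@continuous_normc R)).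
by exists (normc (f c)); [exact: normc_ge0|].
Qed.

Lemma entire_affine f a c : entire f -> entire (fun z => f (a * z + c)).
Proof.
move=> ef z; apply/derivableCP; have /derivableCP[d hd] := ef (a * z + c).
exists (d * a) => e e0; have A0 : 0 < normc a + 1 by rewrite ltr_wpDl ?normc_ge0.
have [del del0 {}hd] := hd _ (divr_gt0 e0 A0).
exists (del / (normc a + 1)); first exact: divr_gt0.
move=> h; rewrite ltr_pdivlMr// => hh.
have ah : normc (a * h) <= normc h * (normc a + 1).
  by rewrite Normc.normcM mulrDr mulr1 mulrC lerDl normc_ge0.
have := hd (a * h) (le_lt_trans ah hh).
rewrite (_ : a * z + c + a * h = a * (z + h) + c); last by rewrite mulrDr addrAC.
rewrite mulrA => /le_trans; apply; rewrite mulrAC ler_pdivrMr// -mulrA.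
by rewrite ler_pM2l.
Qed.

Lemma entireB f g : entire f -> entire g -> entire (fun z => f z - g z).
Proof. by move=> ef eg z; exact: derivableB (ef z) (eg z). Qed.

Lemma entireZ (k : C) f : entire f -> entire (fun z => k * f z).
Proof. by move=> ef z; exact: (@derivableZ _ C^o C^o f k z 1 (ef z)). Qed.

Lemma submean_normc_entire f : entire f -> submean (fun z => normc (f z)).
Proof.
move=> ef; have dF c : exists2 r0 : R, 0 < r0 &
     forall w, 0 < normc (w - c) < r0 -> derivable (f : C^o -> C^o) w 1.
  by exists 1 => // w _; exact: ef.
exact: submean_normcT (entire_continuous ef) dF.
Qed.

(** The quotient of increments is holomorphic off its centre and continuous
    there, so the maximum principle bounds it by its values on a circle. *)
Lemma entire_lipschitz f a (rho M : R) : entire f ->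
  (forall w, normc w <= rho + 1 -> normc (f w) <= M) -> normc a <= rho ->
  forall h, normc h <= 1 -> normc (f (a + h) - f a) <= 2 * M * normc h.
Proof.
move=> ef fM ar; have /derivableCP[d hd] := ef a.
pose G h := h^-1 * (f (a + h) - f a); pose Q h := if h == 0 then d else G h.
have eD : entire (fun h => f (a + h) - f a).
  apply: entireB; last by move=> z; exact: derivable_cst.
  have := @entire_affine f 1 a ef; congr entire.
  by apply/funext => z; rewrite mul1r addrC.
have dQ w : w != 0 -> derivable (Q : C^o -> C^o) w 1.
  move=> w0; apply: (@near_eq_derivable _ C^o C^o G).
    apply/nearC; exists (normc w); first by rewrite normc_gt0.
    move=> v vw; rewrite /Q; case: eqVneq => // v0.
    by move: vw; rewrite v0 sub0r -[- w]add0r normcB subr0 ltxx.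
  apply: derivableM; last exact: eD.
  by apply: derivableV => //; exact: derivable_id.
have cQ : continuous (Q : C^o -> C^o).
  move=> w; have [->|w0] := eqVneq w 0; last first.
    exact/differentiable_continuous/derivable1_diffP/dQ.
  apply: (@cvgC_normc R C _ (nbhs_filter (0 : C^o)) _ _).2 => e e0.
  have [del del0 hh] := hd _ (divr_gt0 e0 (ltr0Sn R 1)).
  apply/nearC; exists del => // v; rewrite subr0 => vd.
  rewrite /Q eqxx; case: eqVneq => [_|v0]; first by rewrite subrr Normc.normc0.
  rewrite normcB -(ltr_pM2r (x := normc v)) ?normc_gt0// -Normc.normcM mulrBl.
  rewrite /G mulrAC mulVf// mul1r; apply: le_lt_trans (hh _ vd) _.
  by rewrite ltr_pM2r ?normc_gt0// ltr_pdivrMr// ltr_pMr// ltr1n.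
have sQ : submean (fun z => normc (Q z)).
  apply: (submean_normcT cQ) => c; have [->|c0] := eqVneq c 0.
    by exists 1 => // w; rewrite subr0 => /andP[w0 _]; apply: dQ; rewrite -normc_gt0.
  exists (normc c); first by rewrite normc_gt0.
  move=> w /andP[_ wc]; apply: dQ; apply: contraTneq wc => ->.
  by rewrite -leNgt normcB subr0.
have Q1 w : normc w = 1 -> normc (Q w) <= 2 * M.
  move=> w1; rewrite /Q; case: eqVneq => [w0|w0].
    by move: w1; rewrite w0 Normc.normc0 => /eqP; rewrite eq_sym oner_eq0.
  rewrite /G Normc.normcM Normc.normcV w1 invr1 mul1r.
  apply: le_trans (normcD _ _) _; rewrite -[- f a]add0r normcB subr0 mulr_natl mulr2n.
  apply: lerD; apply: fM; last by rewrite (le_trans ar)// lerDl.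
  by apply: le_trans (normcD _ _) _; rewrite w1 lerD2r.
move=> h h1; have := maximum_principle sQ Q1 h1.
rewrite /Q; case: eqVneq => [->|h0]; first by rewrite addr0 subrr Normc.normc0 mulr0.
by rewrite /G Normc.normcM Normc.normcV mulrC ler_pdivrMr ?normc_gt0.
Qed.

(** Bisecting an increment [h] compares the difference quotients of steps [h] and
    [h / 2]; both are values of one difference quotient, which is itself an entire
    function of the base point, hence locally Lipschitz. *)
Lemma entire_quadratic_bound f (rho M : R) : entire f ->
  (forall w, normc w <= rho + 2 -> normc (f w) <= M) ->
  forall w d, normc w <= rho ->
  (forall e : R, 0 < e -> exists2 del : R, 0 < del &
    forall h, normc h < del -> normc (f (w + h) - f w - d * h) <= e * normc h) ->
  forall h, normc h <= 1 -> normc (f (w + h) - f w - d * h) <= 2 * M * normc h ^+ 2.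
Proof.
move=> ef fM w d wr hd h h1.
have [->|h0] := eqVneq h 0.
  by rewrite addr0 subrr mulr0 subrr Normc.normc0 expr0n/= mulr0.
pose D (k u : C) := k^-1 * (f (u + k) - f u).
have n2 : normc (2^-1 : C) = 2^-1.
  by apply: (@complexI R); rewrite -normC_normc normfV normr_nat fmorphV rmorph_nat.
have step k : k != 0 -> normc k <= 1 -> normc (D k w - D (k / 2) w) <= M * normc k.
  move=> k0 k1; have k20 : k / 2 != 0 by rewrite mulf_neq0// invr_eq0 pnatr_eq0.
  have nk2 : normc (k / 2) = normc k / 2 by rewrite Normc.normcM n2.
  have k21 : normc (k / 2) <= 1.
    by rewrite nk2 ler_pdivrMr// mul1r (le_trans k1)// ler1n.
  have eD : entire (D (k / 2)).
    have e1 : entire (fun u => f (u + k / 2)).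
      have := @entire_affine f 1 (k / 2) ef; congr entire.
      by apply/funext => z; rewrite mul1r.
    exact: (@entireZ (k / 2)^-1 _ (entireB e1 ef)).
  have DM u : normc u <= rho + 1 -> normc (D (k / 2) u) <= 2 * M.
    move=> ur; rewrite /D Normc.normcM Normc.normcV mulrC ler_pdivrMr ?normc_gt0//.
    apply: (@entire_lipschitz f u (rho + 1) M) => // v vr; apply: fM.
    by apply: le_trans vr _; rewrite -addrA lerD2l.
  have := entire_lipschitz eD DM wr k21; rewrite nk2 => hL.
  have -> : D k w - D (k / 2) w = 2^-1 * (D (k / 2) (w + k / 2) - D (k / 2) w).
    rewrite /D invfM invrK -addrA -splitr; field.
    by rewrite k0.
  rewrite Normc.normcM n2 mulrC ler_pdivrMr//; apply: le_trans hL _.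
  by rewrite le_eqVlt; apply/orP; left; apply/eqP; field.
have p2 n : (2 ^+ n : C) != 0 by rewrite expf_neq0// pnatr_eq0.
have nh n : normc (h / 2 ^+ n) = normc h / 2 ^+ n.
  by elim: n => [|n IH]; rewrite ?expr0 ?divr1// exprSr invfM mulrA Normc.normcM n2 IH exprSr invfM mulrA.
have M0 : 0 <= M by apply: le_trans (normc_ge0 (f w)) (fM _ _); rewrite (le_trans wr)// lerDl.
have tele n : normc (D h w - D (h / 2 ^+ n) w) <= 2 * M * normc h * (1 - 2^-1 ^+ n).
  elim: n => [|n IH]; first by rewrite !expr0 divr1 subrr Normc.normc0 subrr mulr0.
  have hn1 : normc (h / 2 ^+ n) <= 1.
    by rewrite nh ler_pdivrMr ?exprn_gt0// mul1r (le_trans h1)// exprn_ege1// ler1n.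
  have hn0 : h / 2 ^+ n != 0 by rewrite mulf_neq0 ?invr_eq0.
  have hE : h / 2 ^+ n / 2 = h / 2 ^+ n.+1 by rewrite exprSr invfM mulrA.
  have := step _ hn0 hn1; rewrite hE nh => st.
  rewrite -(subrK (D (h / 2 ^+ n) w) (D h w)) -addrA.
  apply: le_trans (normcD _ _) _; apply: le_trans (lerD IH st) _.
  rewrite -exprVn exprSr le_eqVlt; apply/orP; left; apply/eqP.
  by set x := 2^-1 ^+ n; field.
have lim : normc (D h w - d) <= 2 * M * normc h.
  apply/ler_addgt0Pr => e e0; have [del del0 hdel] := hd _ e0.
  have [N hN] : exists N : nat, normc h / 2 ^+ N < del.
    have := @cvg_geometric R (normc h) 2^-1.
    rewrite ger0_norm ?invr_ge0// invf_lt1// ltr1n => /(_ isT) /cvgr0_norm_lt /(_ del del0).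
    case=> N _ /(_ N (leqnn N)); rewrite /geometric/= exprVn ger0_norm; first by exists N.
    by rewrite mulr_ge0 ?normc_ge0// invr_ge0 exprn_ge0.
  rewrite -nh in hN; have := hdel _ hN.
  have kn0 : h / 2 ^+ N != 0 by rewrite mulf_neq0 ?invr_eq0.
  set k := h / 2 ^+ N in hN kn0 * => hk.
  have Dk : normc (D k w - d) <= e.
    rewrite -(@ler_pM2r _ (normc k)) ?normc_gt0// -Normc.normcM mulrBl.
    by rewrite /D mulrAC mulVf// mul1r.
  rewrite -(subrK (D k w) (D h w)) -addrA.
  apply: le_trans (normcD _ _) _; apply: lerD => //; apply: le_trans (tele N) _.
  by rewrite ler_piMr ?mulr_ge0 ?normc_ge0// lerBlDr lerDl exprn_ge0.
have -> : f (w + h) - f w - d * h = (D h w - d) * h.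
  by rewrite mulrBl /D mulrAC mulVf// mul1r.
by rewrite Normc.normcM expr2 mulrA ler_wpM2r ?normc_ge0.
Qed.

(** Continuity of the derivative comes for free: expanding at two points in opposite
    directions bounds the difference of the two derivatives. *)
Lemma entire_quadratic f : entire f -> exists2 f' : C -> C,
  continuous (f' : C^o -> C^o) &
  forall rho : R, exists2 K : R, 0 <= K &
    forall w h, normc w <= rho -> normc h <= 1 ->
      normc (f (w + h) - f w - f' w * h) <= K * normc h ^+ 2.
Proof.
move=> ef; have [f' hf'] := choice (fun z => (derivableCP f z).1 (ef z)).
have quad (rho : R) : exists2 K : R, 0 <= K &
    forall w h, normc w <= rho -> normc h <= 1 ->
      normc (f (w + h) - f w - f' w * h) <= K * normc h ^+ 2.
  have [M M0 fM] := entire_bounded (rho + 2) ef.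
  exists (2 * M); first by rewrite mulr_ge0.
  by move=> w h wr h1; apply: (entire_quadratic_bound ef fM wr (hf' w)).
exists f'; last exact: quad.
move=> z; apply: (@cvgC_normc R C _ (nbhs_filter (z : C^o)) _ _).2 => e e0.
have [K K0 hK] := quad (normc z + 1).
have K1 : 0 < 2 * (K + 1) by rewrite mulr_gt0// ltr_wpDl.
apply/nearC; exists (Num.min 1 (e / (2 * (K + 1)))).
  by rewrite lt_min ltr01 divr_gt0.
move=> w; rewrite lt_min => /andP[w1 we].
have [->|wz] := eqVneq w z; first by rewrite subrr Normc.normc0.
set h := w - z in w1 we *; have hw : z + h = w by rewrite addrC subrK.
have hz : w + (- h) = z by rewrite -hw addrK.
have nh : normc (- h) = normc h by rewrite -[- h]sub0r normcB subr0.
have h0 : 0 < normc h by rewrite normc_gt0 subr_eq0.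
have z1 : normc z <= normc z + 1 by rewrite lerDl.
have w2 : normc w <= normc z + 1.
  by rewrite -hw; apply: le_trans (normcD _ _) _; rewrite lerD2l ltW.
have k1 := hK z h z1 (ltW w1).
have k2 := hK w (- h) w2; rewrite nh in k2; have {}k2 := k2 (ltW w1).
rewrite hw in k1; rewrite hz in k2.
rewrite -(@ltr_pM2r _ (normc h))// -Normc.normcM normcB.
have -> : (f' z - f' w) * h = - (f w - f z - f' z * h) - (f z - f w - f' w * - h) by ring.
apply: le_lt_trans (normcD _ _) _.
rewrite -[X in normc X + _]sub0r -[X in _ + normc X]sub0r ![normc (0 - _)]normcB !subr0.
apply: le_lt_trans (lerD k1 k2) _.
rewrite ltr_pdivlMr// in we.
have -> : K * normc h ^+ 2 + K * normc h ^+ 2 = 2 * K * normc h * normc h by ring.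
rewrite [X in _ < e * X]normcB -/h ltr_pM2r//; lra.
Qed.

End DifferenceQuotients.

(** * Riemann sums of periodic functions *)

Section RiemannSums.
Context {R : realType}.
Local Notation leb := (@lebesgue_measure R).
Implicit Types g : R -> R.

(** Uniform continuity on a segment: on the compact set of pairs whose images
    are far apart, the distance has a positive minimum. *)
Lemma segment_unif_continuous g (a b e : R) : continuous g -> 0 < e ->
  exists2 del : R, 0 < del & forall x y, a <= x <= b -> a <= y <= b ->
    `|x - y| < del -> `|g x - g y| < e.
Proof.
move=> cg e0; pose dg (p : R * R) := `|g p.1 - g p.2|.
have cB (u v : R * R -> R) : continuous u -> continuous v ->
    continuous (fun p => `|u p - v p|).
  move=> cu cv; apply: (continuous_funcomp (h := fun x : R => `|x|)); last exact: norm_continuous.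
  by move=> p; apply: cvgB; [exact: cu|exact: cv].
have c1 : continuous (fun p : R * R => p.1) by move=> p; exact: cvg_fst.
have c2 : continuous (fun p : R * R => p.2) by move=> p; exact: cvg_snd.
have cdg : continuous dg by apply: cB; [exact: continuous_funcomp c1 cg|exact: continuous_funcomp c2 cg].
pose K := (`[a, b] `*` `[a, b]) `&` [set p | e <= dg p].
have Kc : compact K.
  apply: compact_closedI; first by apply: compact_setX; exact: segment_compact.
  rewrite (_ : [set p | _] = dg @^-1` [set x | e <= x])//.
  by apply: closed_comp; [move=> p _; exact: cdg|exact: closed_ge].
have [K0|/set0P K0] := eqVneq K set0.
  exists 1 => // x y xab yab _; rewrite ltNge; apply/negP => h.
  have : K (x, y) by split => //; split; rewrite /= in_itv.
  by rewrite K0.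
have [|p] := @compact_EVT_min _ R (fun p : R * R => `|p.1 - p.2|) K K0 Kc.
  by apply: continuous_subspaceT; exact: cB.
rewrite inE => -[_ /= pe] pmin; exists `|p.1 - p.2|.
  rewrite normr_gt0 subr_eq0; apply: contraTneq pe => E.
  by rewrite /dg E subrr normr0 -ltNge.
move=> x y xab yab; apply: contraTT; rewrite -!leNgt => h.
by apply: (pmin (x, y)); rewrite inE; split => //; split; rewrite /= in_itv.
Qed.

(** The integral over one period has zero derivative with respect to its starting
    point. *)
Lemma periodic_integral g (a al : R) : continuous g ->
  (forall t, g (t + 2 * pi) = g t) -> a < - `|al| ->
  \int[leb]_(t in `[a, al + 2 * pi]) g t - \int[leb]_(t in `[a, al]) g t =
  \int[leb]_(t in `[0, 2 * pi]) g t.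
Proof.
move=> cg per aal; have p0 := @pi2_gt0 R.
pose A x := \int[leb]_(t in `[a, x]) g t; pose B x := A (x + 2 * pi) - A x.
have al1 : - `|al| <= al <= `|al| by rewrite -ler_norml.
have al0 := normr_ge0 al.
have dB x : a < x -> is_derive x 1 B 0.
  move=> ax; have d2 : is_derive x 1 A (g x) by exact: is_derive_Rintegral.
  have d1' : is_derive (x + 2 * pi) 1 A (g x).
    by rewrite -(per x); apply: is_derive_Rintegral => //; rewrite (lt_trans ax)// ltrDl.
  have d0 : is_derive x 1 (fun y : R => y + 2 * pi) 1.
    by apply: is_derive_eq; rewrite addr0.
  have d1 : is_derive x 1 (fun y => A (y + 2 * pi)) (g x).
    have := @is_derive1_comp _ A (fun y : R => y + 2 * pi) x (g x) 1 d1' d0.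
    by rewrite mulr1.
  by have := is_deriveB d1 d2; rewrite subrr.
have Bc x y : a < x -> x <= y -> B y = B x.
  move=> ax xy; apply/eqP; rewrite -subr_eq0 -normr_le0 -[leRHS](mul0r (y - x)).
  apply: (@normr_le_MVT R B (fun=> 0)) => // z /andP[xz _]; last by rewrite normr0.
  by apply: dB; rewrite (lt_le_trans ax).
have -> : \int[leb]_(t in `[0, 2 * pi]) g t = B 0.
  by rewrite /B /A add0r RintegralB_itv// ltW//; lra.
rewrite -[LHS]/(B al) (Bc (- `|al|) al)//; last by case/andP: al1.
by rewrite (Bc (- `|al|) 0)// oppr_le0.
Qed.

Definition node_avg g (N : nat) (al : R) :=
  N%:R^-1 * \sum_(k < N) g (al + k%:R * (2 * pi / N%:R)).

Lemma node_avg_cvg g (e : R) : continuous g -> (forall t, g (t + 2 * pi) = g t) ->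
  0 < e -> exists N0 : nat, forall N (al : R), (N0 < N)%N -> `|al| <= pi ->
    `|node_avg g N al - circle_avg g| <= e.
Proof.
move=> cg per e0; have p0 := @pi2_gt0 R; have pp := pi_gt0 R.
have [del del0 uc] := segment_unif_continuous (- pi) (3 * pi) cg e0.
have [N0 hN0] : exists N0 : nat, 2 * pi / del < N0%:R.
  by exists (Num.bound (2 * pi / del)); rewrite archi_boundP// divr_ge0// ltW.
exists N0 => N al N0N alp.
have Npos : 0 < N%:R :> R by rewrite ltr0n (leq_ltn_trans _ N0N).
pose h : R := 2 * pi / N%:R; have h0 : 0 < h by rewrite divr_gt0.
have hN : N%:R * h = 2 * pi by rewrite /h mulrC divfK// gt_eqF.
have hdel : h < del.
  rewrite ltr_pdivrMr// [del * _]mulrC -ltr_pdivrMr//; apply: (lt_trans hN0).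
  by rewrite ltr_nat.
move: alp; rewrite ler_norml => /andP[al1 al2].
pose a := - (`|al| + 1 + pi); pose A x := \int[leb]_(t in `[a, x]) g t.
have al0 := normr_ge0 al.
have aal : a < - `|al| by rewrite /a; lra.
have api : a < - pi by rewrite /a; lra.
pose x (k : nat) := al + k%:R * h.
have stepA k : (k < N)%N -> `|A (x k.+1) - A (x k) - h * g (x k)| <= e * h.
  move=> kN; have xk1 : x k.+1 = x k + h by rewrite /x -natr1 mulrDl mul1r addrA.
  have xk0 : al <= x k by rewrite /x lerDl mulr_ge0// ltW.
  have xk2 : x k.+1 <= al + 2 * pi by rewrite /x lerD2l -hN ler_pM2r// ler_nat.
  pose D t := A t - g (x k) * t.
  have -> : A (x k.+1) - A (x k) - h * g (x k) = D (x k.+1) - D (x k).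
    by rewrite /D xk1; ring.
  rewrite [X in e * X](_ : h = x k.+1 - x k); last by rewrite xk1 addrC addKr.
  apply: (@normr_le_MVT R D (fun t => g t - g (x k))).
  - by rewrite xk1 lerDl ltW.
  - move=> t /andP[xt tx]; have dA : is_derive t 1 A (g t).
      by apply: is_derive_Rintegral => //; lra.
    rewrite /D; apply: is_deriveB; apply: is_derive_eq.
    by rewrite scaler1.
  - move=> t /andP[xt tx]; apply/ltW/uc.
    + by apply/andP; split; lra.
    + by apply/andP; split; lra.
    + by rewrite ger0_norm ?subr_ge0//; lra.
have tele n : (n <= N)%N ->
    `|A (x n) - A al - h * \sum_(k < n) g (x k)| <= n%:R * (e * h).
  elim: n => [|n IH] nN.
    by rewrite big_ord0 /x mul0r addr0 subrr mulr0 subr0 normr0 mul0r.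
  have {}IH := IH (ltnW nN); have st := stepA n nN.
  rewrite big_ord_recr/= -natr1 mulrDl mul1r.
  apply: le_trans (lerD IH st); rewrite -[leLHS]/(`| _ |).
  apply: le_trans (ler_normD _ _); apply/eq_ler; congr (`| _ |); ring.
have hT := tele N (leqnn N).
have xN : x N = al + 2 * pi by rewrite /x hN.
rewrite xN mulrCA hN (periodic_integral cg per aal) in hT.
rewrite circle_avg.unlock /node_avg -/h.
set I := Rintegral _ _ _ in hT *; set S := \sum_(k < N) _ in hT *.
have -> : N%:R^-1 * S - (2 * pi)^-1 * I = - ((2 * pi)^-1 * (I - h * S)).
  rewrite /h mulrBr opprB; congr (_ - _).
  by rewrite [2 * pi / _]mulrC -mulrA [RHS]mulrCA mulKf// gt_eqF.
rewrite normrN normrM (gtr0_norm (x := (2 * pi)^-1)) ?invr_gt0// ler_pdivrMl//.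
by rewrite [2 * pi * e]mulrC.
Qed.

End RiemannSums.

(** * Means over regular polygons and over circles *)

Section NodeMeans.
Context {R : realType}.
Local Open Scope complex_scope.
Local Notation C := R[i].
Local Notation normc := (@Normc.normc R).
Implicit Types (z w : C) (f g : C -> C) (s r : R).

Definition root_node (N k : nat) : C := circle_point 1 (k%:R * (2 * pi / N%:R)).

(** The mean over the vertices of a regular polygon: exchanging it with an integral
    takes additivity alone. *)
Definition node_mean f s (N : nat) z : R :=
  N%:R^-1 * \sum_(k < N) normc (f (root_node N k * z)) `^ s.

Definition circle_mean f s r : R :=
  circle_avg (fun t => normc (f (circle_point r t)) `^ s).

Lemma circle_pointD r (a b : R) :
  circle_point 1 b * circle_point r a = circle_point r (a + b).
Proof. by apply/eqP; rewrite eq_complex /= cosD sinD; apply/andP; split; apply/eqP; ring. Qed.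

Lemma node_mean_circle f s N r (t : R) :
  node_mean f s N (circle_point r t) =
  node_avg (fun t => normc (f (circle_point r t)) `^ s) N t.
Proof.
by congr (_ * _); apply: eq_bigr => k _; rewrite circle_pointD.
Qed.

Lemma continuous_circle_powR f s r : 0 < s -> continuous (f : C^o -> C^o) ->
  continuous (fun t => normc (f (circle_point r t)) `^ s).
Proof.
move=> s0 cf; have -> : (fun t => normc (f (circle_point r t)) `^ s) =
    (fun t => normc (f (0 + circle_point r t)) `^ s).
  by apply/funext => t; rewrite add0r.
exact: (@continuous_on_circle _ _ 0 r (continuous_powR_normc s0 cf)).
Qed.

Lemma node_mean_submean f s N : 1 <= s -> entire f -> submean (node_mean f s N).
Proof.
move=> s1 ef; apply: submeanZ; first by rewrite invr_ge0.
apply: (@submean_sum R N (fun k z => normc (f (root_node N k * z)) `^ s)) => k.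
have ek : entire (fun z => f (root_node N k * z)).
  have := @entire_affine _ f (root_node N k) 0 ef; congr entire.
  by apply/funext => z; rewrite addr0.
have dF c : exists2 r0 : R, 0 < r0 & forall w, 0 < normc (w - c) < r0 ->
    derivable ((fun z => f (root_node N k * z)) : C^o -> C^o) w 1.
  by exists 1 => // w _; exact: ek.
exact: (submean_powR s1 (entire_continuous ek) dF).
Qed.

(** Riemann sums converge uniformly in the base angle, so a comparison of finite
    means with the maximum over a whole circle passes to the integral means. *)
Lemma circle_mean_le f g s r (K : R) : 0 < s -> 0 <= r -> 0 <= K ->
  continuous (f : C^o -> C^o) -> continuous (g : C^o -> C^o) ->
  (forall N (M : R), (0 < N)%N -> (forall w, normc w = r -> node_mean f s N w <= M) ->
     node_mean g s N (circle_point r 0) <= K * M) ->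
  circle_mean g s r <= K * circle_mean f s r.
Proof.
move=> s0 r0 K0 cf cg h.
suff H (e : R) : 0 < e -> circle_mean g s r <= K * circle_mean f s r + (K + 1) * e.
  apply/ler_addgt0Pr => e e0; have K1 : 0 < K + 1 by rewrite ltr_wpDl.
  apply: le_trans (H (e / (K + 1)) (divr_gt0 e0 K1)) _.
  by rewrite mulrCA divff ?mulr1// gt_eqF.
move=> e0.
have cF := @continuous_circle_powR f s r s0 cf; have cG := @continuous_circle_powR g s r s0 cg.
have pF t : normc (f (circle_point r (t + 2 * pi))) `^ s = normc (f (circle_point r t)) `^ s.
  by rewrite circle_point2pi.
have pG t : normc (g (circle_point r (t + 2 * pi))) `^ s = normc (g (circle_point r t)) `^ s.
  by rewrite circle_point2pi.
have [N1 h1] := node_avg_cvg cF pF e0; have [N2 h2] := node_avg_cvg cG pG e0.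
pose N := (maxn N1 N2).+1.
have N1N : (N1 < N)%N by rewrite ltnS leq_maxl.
have N2N : (N2 < N)%N by rewrite ltnS leq_maxr.
have := h N (circle_mean f s r + e) isT.
have -> : node_mean g s N (circle_point r 0) =
  node_avg (fun t => normc (g (circle_point r t)) `^ s) N 0 by exact: node_mean_circle.
have pi0 : `|0 : R| <= pi by rewrite normr0 pi_ge0.
have := h2 N 0 N2N pi0; rewrite ler_distl => /andP[gle _] hh.
have {}hh : node_avg (fun t => normc (g (circle_point r t)) `^ s) N 0 <=
    K * (circle_mean f s r + e).
  apply: hh => w wr; have [t tpi ->] := circle_point_surj w.
  rewrite wr node_mean_circle; have := h1 N t N1N tpi.
  by rewrite ler_distl => /andP[].
rewrite -[circle_avg _]/(circle_mean g s r) in gle.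
have := le_trans gle hh; lra.
Qed.

Lemma node_mean_max f s N r (M : R) : 1 <= s -> entire f ->
  (forall w, normc w = r -> node_mean f s N w <= M) ->
  forall z, normc z <= r -> node_mean f s N z <= M.
Proof.
by move=> s1 ef fM z zr; exact: (maximum_principle (@node_mean_submean f s N s1 ef) fM zr).
Qed.

(** A contraction of the plane turns means of [f] over polygons inscribed in the larger
    circle into means over the smaller one, where the maximum principle applies. *)
Lemma circle_mean_mono f s (r1 r2 : R) : 1 <= s -> entire f -> 0 <= r1 -> r1 <= r2 ->
  circle_mean f s r1 <= circle_mean f s r2.
Proof.
move=> s1 ef r10 r12; have r20 := le_trans r10 r12.
have s0 : 0 < s by rewrite (lt_le_trans _ s1).
have [r2E|r2n] := eqVneq r2 0.
  by rewrite (_ : r1 = r2)//; apply: le_anti; rewrite r12 r2E r10.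
pose a : C := (r1 / r2)%:C; pose g z := f (a * z).
have r2p : 0 < r2 by rewrite lt_neqAle eq_sym r2n.
have eg : entire g.
  have := @entire_affine _ f a 0 ef; congr entire.
  by apply/funext => z; rewrite addr0.
have aE t : a * circle_point r2 t = circle_point r1 t.
  apply/eqP; rewrite eq_complex /= !mul0r subr0 addr0.
  by rewrite !mulrA divfK// !eqxx.
have na : normc a = r1 / r2.
  by rewrite /= expr0n/= addr0 sqrtr_sqr ger0_norm// divr_ge0.
have -> : circle_mean f s r1 = circle_mean g s r2.
  by congr circle_avg; apply/funext => t; rewrite /g aE.
have [cf cg] := (entire_continuous ef, entire_continuous eg).
rewrite -[leRHS]mul1r; apply: (circle_mean_le s0 r20 ler01 cf cg).
move=> N M N0 fM; rewrite mul1r.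
have -> : node_mean g s N (circle_point r2 0) = node_mean f s N (a * circle_point r2 0).
  by congr (_ * _); apply: eq_bigr => k _; rewrite /g mulrCA.
apply: (node_mean_max s1 ef fM).
by rewrite aE normc_circle ger0_norm.
Qed.

End NodeMeans.

(** * Continuity on the open half-line *)

Section PositiveContinuity.
Context {R : realType}.
Local Open Scope complex_scope.
Local Notation C := R[i].
Local Notation normc := (@Normc.normc R).
Implicit Types (z w : C) (phi : R -> R).

Definition pos_continuous phi := forall t : R, 0 < t -> {for t, continuous phi}.

Lemma pos_continuousD phi psi : pos_continuous phi -> pos_continuous psi ->
  pos_continuous (fun t => phi t + psi t).
Proof. by move=> h1 h2 t t0; apply: cvgD; [exact: h1|exact: h2]. Qed.

Lemma pos_continuousM phi psi : pos_continuous phi -> pos_continuous psi ->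
  pos_continuous (fun t => phi t * psi t).
Proof. by move=> h1 h2 t t0; apply: cvgM; [exact: h1|exact: h2]. Qed.

Lemma pos_continuous_cst (k : R) : pos_continuous (fun=> k).
Proof. by move=> t _; exact: cvg_cst. Qed.

Lemma pos_continuous_inv : pos_continuous GRing.inv.
Proof. by move=> t t0; apply: inv_continuous; rewrite gt_eqF. Qed.

Lemma pos_continuous_measurable phi : pos_continuous phi -> measurable_fun (`]0, +oo[%classic : set R) phi.
Proof.
move=> h; apply: open_continuous_measurable_fun; first exact: interval_open.
by move=> t; rewrite inE/= in_itv/= andbT; exact: h.
Qed.

Lemma divC_real z (t : R) : z / t%:C = (complex.Re z * t^-1) +i* (complex.Im z * t^-1).
Proof.
rewrite -fmorphV/=; case: z => a b; apply/eqP; rewrite eq_complex /=.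
by rewrite !mulr0 subr0 add0r !eqxx.
Qed.

Lemma pos_continuous_path (U : C -> R) z : continuous (U : C^o -> R) ->
  pos_continuous (fun t => U (z / t%:C)).
Proof.
move=> cU t t0; have cp : (fun u : R => z / u%:C : C^o) @ t --> (z / t%:C : C^o).
  have -> : (fun u : R => z / u%:C : C^o) = fun u : R =>
    (complex.Re z * u^-1) +i* (complex.Im z * u^-1) : C^o.
    by apply/funext => u; rewrite divC_real.
  rewrite divC_real.
  by apply: cvg_Complex; apply: cvgM; try exact: cvg_cst; exact: pos_continuous_inv.
exact: (cvg_comp (fun u : R => z / u%:C : C^o) U cp (cU _)).
Qed.

Lemma normc_div_real z (t : R) : 0 < t -> normc (z / t%:C) = normc z / t.
Proof.
move=> t0; rewrite Normc.normcM Normc.normcV /= expr0n/= addr0 sqrtr_sqr.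
by rewrite gtr0_norm.
Qed.

Lemma normc_div_le z (t : R) : 1 <= t -> normc (z / t%:C) <= normc z.
Proof.
move=> t1; have t0 : 0 < t by rewrite (lt_le_trans _ t1).
by rewrite normc_div_real// ler_pdivrMr// ler_peMr// normc_ge0.
Qed.

End PositiveContinuity.

(** * Integration against dmu(t) / t *)

Section WeightedIntegral.
Context {R : realType} (mu : {measure set (measurableTypeR R) -> \bar R}).
Local Open Scope complex_scope.
Local Notation C := R[i].
Local Notation normc := (@Normc.normc R).
Implicit Types (z w : C) (phi psi : R -> R) (f : C -> C).

Definition wint phi : R := \int[mu]_(t in `[1%R, +oo[) (t^-1 * phi t).

Definition wmass : R := wint (fun=> 1).

(** Boundedness is asked for [1 <= t], where the dilation by [1 / t] contracts the
    plane. *)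
Definition admissible phi := pos_continuous phi /\ exists B : R, forall t, 1 <= t -> `|phi t| <= B.

Hypothesis mufin : (\int[mu]_(t in `]0%R, +oo[) (t^-1)%:E < +oo)%E.

Lemma setD_itv01 : `]0, +oo[ `\` `]0, 1[ = `[1, +oo[%classic :> set R.
Proof.
apply/seteqP; split => x /=; rewrite !in_itv/= !andbT.
  by move=> [x0 /negP]; rewrite x0/= -leNgt.
by move=> x1; split; [exact: lt_le_trans x1|case/andP => _; rewrite ltNge x1].
Qed.

Lemma measurable_ge1 phi : pos_continuous phi -> measurable_fun (`[1, +oo[%classic : set R) phi.
Proof.
move=> /pos_continuous_measurable; apply: measurable_funS => //.
by move=> x /=; rewrite !in_itv/= !andbT; exact: lt_le_trans.
Qed.

Lemma integrable_inv : mu.-integrable `[1%R, +oo[ (fun t => (t^-1)%:E).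
Proof.
apply/integrableP; split.
  by apply/measurable_EFinP; exact: (measurable_ge1 (@pos_continuous_inv R)).
have -> : (\int[mu]_(t in `[1%R, +oo[) `|(t^-1)%:E| =
    \int[mu]_(t in `[1%R, +oo[) (t^-1)%:E)%E.
  apply: eq_integral => t; rewrite inE/= in_itv/= andbT => t1.
  by rewrite ger0_norm // invr_ge0 (le_trans ler01 t1).
apply: le_lt_trans mufin; apply: ge0_subset_integral => //.
- by apply/measurable_EFinP; exact: (pos_continuous_measurable (@pos_continuous_inv R)).
- by move=> t; rewrite /= in_itv/= andbT => t0; rewrite lee_fin invr_ge0 ltW.
- by move=> x /=; rewrite !in_itv/= !andbT; exact: lt_le_trans.
Qed.

Lemma wint_integrable phi : admissible phi ->
  mu.-integrable `[1%R, +oo[ (EFin \o (fun t => t^-1 * phi t)).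
Proof.
move=> [cphi [B hB]].
have iB : mu.-integrable `[1%R, +oo[ (fun t => (t^-1 * B)%:E).
  rewrite (_ : (fun t => _) = (fun t => (t^-1)%:E * B%:E)%E); last first.
    by apply/funext => t; rewrite EFinM.
  by apply: integrableZr => //; exact: integrable_inv.
apply: (le_integrable _ _ _ iB) => //.
  by apply/measurable_EFinP; exact: (measurable_ge1 (pos_continuousM (@pos_continuous_inv R) cphi)).
move=> t /=; rewrite in_itv/= andbT => t1; rewrite lee_fin !normrM.
rewrite ler_wpM2l//; apply: le_trans (hB t t1) _; exact: ler_norm.
Qed.

Lemma wint_le phi psi : admissible phi -> admissible psi ->
  (forall t, 1 <= t -> phi t <= psi t) -> wint phi <= wint psi.
Proof.
move=> h1 h2 h; apply: le_Rintegral => //; try exact: wint_integrable.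
move=> t; rewrite /= in_itv/= andbT => t1; apply: ler_wpM2l; last exact: h.
by rewrite invr_ge0 (le_trans _ t1).
Qed.

Lemma admissibleD phi psi : admissible phi -> admissible psi ->
  admissible (fun t => phi t + psi t).
Proof.
move=> [c1 [B1 h1]] [c2 [B2 h2]]; split; first exact: pos_continuousD.
exists (B1 + B2) => t t1; apply: le_trans (ler_normD _ _) _.
by rewrite lerD ?h1 ?h2.
Qed.

Lemma admissibleM phi psi : admissible phi -> admissible psi ->
  admissible (fun t => phi t * psi t).
Proof.
move=> [c1 [B1 h1]] [c2 [B2 h2]]; split; first exact: pos_continuousM.
by exists (B1 * B2) => t t1; rewrite normrM ler_pM ?h1 ?h2.
Qed.

Lemma admissible_cst (k : R) : admissible (fun=> k).
Proof. by split; [exact: pos_continuous_cst|exists `|k|]. Qed.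

Lemma admissibleZ (k : R) phi : admissible phi -> admissible (fun t => k * phi t).
Proof. by move=> h; exact: admissibleM (admissible_cst k) h. Qed.

Lemma admissible_inv : admissible GRing.inv.
Proof.
split; first exact: pos_continuous_inv.
by exists 1 => t t1; rewrite ger0_norm ?invr_ge0 ?(le_trans _ t1)// invf_le1 ?(lt_le_trans _ t1).
Qed.

Lemma admissible_path (U : C -> R) z : continuous (U : C^o -> R) ->
  admissible (fun t => U (z / t%:C)).
Proof.
move=> cU; split; first exact: pos_continuous_path.
have [c _ h] := cdisc_max (normc_ge0 z) (continuous_funcomp cU (@norm_continuous R R^o)).
by exists `|U c| => t t1; apply: h; exact: normc_div_le.
Qed.

Lemma wintD phi psi : admissible phi -> admissible psi ->
  wint (fun t => phi t + psi t) = wint phi + wint psi.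
Proof.
move=> h1 h2; rewrite /wint -RintegralD//; try exact: wint_integrable.
by apply: eq_Rintegral => t _; rewrite mulrDr.
Qed.

Lemma wintZ (k : R) phi : admissible phi -> wint (fun t => k * phi t) = k * wint phi.
Proof.
move=> h1; rewrite /wint -RintegralZl//; last exact: wint_integrable.
by apply: eq_Rintegral => t _; rewrite mulrCA.
Qed.

Lemma wint_cst (k : R) : wint (fun=> k) = k * wmass.
Proof.
by rewrite -(wintZ k (admissible_cst 1)); apply: eq_Rintegral => t _; rewrite mulr1.
Qed.

Lemma wmass_ge0 : 0 <= wmass.
Proof.
apply: Rintegral_ge0 => t; rewrite /= in_itv/= andbT => t1.
by rewrite mulr1 invr_ge0 (le_trans _ t1).
Qed.

Lemma wint_sum N (phi : nat -> R -> R) : (forall k, admissible (phi k)) ->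
  admissible (fun t => \sum_(k < N) phi k t) /\
  wint (fun t => \sum_(k < N) phi k t) = \sum_(k < N) wint (phi k).
Proof.
move=> h; elim: N => [|N [IH1 IH2]].
  rewrite big_ord0 (_ : (fun t => \sum_(k < 0) phi k t) = fun=> 0); last first.
    by apply/funext => t; rewrite big_ord0.
  by split; [exact: admissible_cst|rewrite wint_cst mul0r].
rewrite big_ord_recr/= (_ : (fun t => \sum_(k < N.+1) phi k t) =
  fun t => \sum_(k < N) phi k t + phi N t); last first.
  by apply/funext => t; rewrite big_ord_recr.
by split; [exact: admissibleD|rewrite wintD// IH2].
Qed.

(** As for real parts and moduli on circles: the modulus of the integral is itself the
    integral of a linear combination whose coefficient vector has length one. *)
Lemma wint_normc a b n : admissible a -> admissible b -> admissible n ->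
  (forall t, 1 <= t -> normc (a t +i* b t) <= n t) ->
  normc (wint a +i* wint b) <= wint n.
Proof.
move=> wa wb wn h; set A := wint a; set B := wint b; set rho := normc _.
have n0 : 0 <= wint n.
  rewrite -[leLHS](mul0r wmass) -wint_cst; apply: wint_le => //; first exact: admissible_cst.
  by move=> t t1; apply: le_trans (h t t1); exact: normc_ge0.
have [->//|r0] := eqVneq rho 0.
have rp : 0 < rho by rewrite lt_neqAle eq_sym r0 normc_ge0.
have rE : rho = (A / rho) * A + (B / rho) * B.
  have : rho ^+ 2 = A ^+ 2 + B ^+ 2 by rewrite sqr_sqrtr// addr_ge0 ?sqr_ge0.
  move=> h2; apply: (mulIf r0); rewrite -expr2 h2; field.
  by rewrite r0.
rewrite rE -(wintZ _ wa) -(wintZ _ wb) -wintD; [|exact: admissibleZ|exact: admissibleZ].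
apply: wint_le => //; first by apply: admissibleD; exact: admissibleZ.
move=> t t1; apply: le_trans (h t t1).
rewrite -(ler_pM2l rp) -[rho in leRHS]/(normc (A +i* B)).
have -> : normc (A +i* B) = normc (A -i* B) by rewrite /= sqrrN.
rewrite -Normc.normcM; apply: le_trans (normc_ge_Re _); apply: le_trans (ler_norm _).
rewrite /= le_eqVlt; apply/orP; left; apply/eqP; field.
by rewrite r0.
Qed.

(** Jensen for the weight [dmu / t], by integrating the tangent line at the mean. *)
Lemma wint_powR n (s : R) : 1 <= s -> admissible n -> admissible (fun t => n t `^ s) ->
  (forall t, 1 <= t -> 0 <= n t) ->
  wint n `^ s <= wmass `^ (s - 1) * wint (fun t => n t `^ s).
Proof.
move=> s1 wn wns n0; have s0 : 0 < s by rewrite (lt_le_trans _ s1).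
have W0 : 0 <= wint n.
  rewrite -[leLHS](mul0r wmass) -wint_cst; apply: wint_le => //; exact: admissible_cst.
have [c0|cn] := eqVneq wmass 0.
  have [_ [B hB]] := wn; have : wint n <= B * wmass.
    rewrite -wint_cst; apply: wint_le => //; first exact: admissible_cst.
    by move=> t t1; apply: le_trans (ler_norm _) (hB t t1).
  rewrite c0 mulr0 => Wle; have -> : wint n = 0 by apply: le_anti; rewrite Wle.
  rewrite powR0 ?gt_eqF// mulr_ge0 ?powR_ge0//.
  rewrite -[leLHS](mul0r wmass) -wint_cst; apply: wint_le => //; first exact: admissible_cst.
  by move=> t _; exact: powR_ge0.
have cp : 0 < wmass by rewrite lt_neqAle eq_sym cn wmass_ge0.
pose m := wint n / wmass; have m0 : 0 <= m by rewrite divr_ge0// ltW.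
have mE : wint n = wmass * m by rewrite /m mulrC divfK.
pose k := s * m `^ (s - 1).
have h : wint (fun t => (m `^ s - k * m) + k * n t) <= wint (fun t => n t `^ s).
  apply: wint_le => //; first by apply: admissibleD; [exact: admissible_cst|exact: admissibleZ].
  move=> t t1; apply: le_trans (powR_tangent s1 m0 (n0 t t1)); apply/eq_ler.
  by rewrite /k; ring.
rewrite wintD in h; [|exact: admissible_cst|exact: admissibleZ].
rewrite wint_cst (wintZ _ wn) mE in h.
rewrite mE powRM ?(ltW cp)// -(mulr_powRB1 (ltW cp) s0) mulrAC.
rewrite [_ * wmass `^ _]mulrC; apply: ler_wpM2l; first exact: powR_ge0.
by apply: le_trans h; apply/eq_ler; ring.
Qed.

End WeightedIntegral.

(** * The Hausdorff operator on entire functions *)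

Section HausdorffOperator.
Context {R : realType} (mu : {measure set (measurableTypeR R) -> \bar R}).
Local Open Scope complex_scope.
Local Notation C := R[i].
Local Notation normc := (@Normc.normc R).
Implicit Types (z w h : C) (phi psi : R -> R) (f g : C -> C).
Local Notation W := (wint mu).
Local Notation c := (wmass mu).

Hypothesis mu01 : mu [set` `]0%R, 1%R[] = 0%E.
Hypothesis mufin : (\int[mu]_(t in `]0%R, +oo[) (t^-1)%:E < +oo)%E.

Lemma wint_halfline phi : admissible phi ->
  mu.-integrable `]0%R, +oo[ (EFin \o (fun t => t^-1 * phi t)) /\
  \int[mu]_(t in `]0%R, +oo[) (t^-1 * phi t) = W phi.
Proof.
move=> wphi; have [cphi _] := wphi.
have mp : measurable_fun (`]0, +oo[%classic : set R) (fun t => t^-1 * phi t).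
  exact: (pos_continuous_measurable (pos_continuousM (@pos_continuous_inv R) cphi)).
have ip : mu.-integrable `]0%R, +oo[ (EFin \o (fun t => t^-1 * phi t)).
  apply/integrableP; split; first exact/measurable_EFinP.
  have [_] := integrableP _ _ _ (wint_integrable mufin wphi); apply: le_lt_trans.
  rewrite (@ge0_negligible_integral _ _ _ mu `]0%R, +oo[ `]0%R, 1%R[)//.
    by rewrite setD_itv01.
  by apply: measurableT_comp => //; exact/measurable_EFinP.
split => //; rewrite /wint /Rintegral.
rewrite (@negligible_integral _ _ _ mu `]0%R, +oo[ `]0%R, 1%R[)//.
by rewrite setD_itv01.
Qed.

Lemma Re_integrand f z (t : R) :
  complex.Re (Hausdorff_integrand f z t) = t^-1 * complex.Re (f (z / t%:C)).
Proof. by rewrite /Hausdorff_integrand; case: (f _) => a b /=; rewrite mul0r subr0. Qed.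

Lemma Im_integrand f z (t : R) :
  complex.Im (Hausdorff_integrand f z t) = t^-1 * complex.Im (f (z / t%:C)).
Proof. by rewrite /Hausdorff_integrand; case: (f _) => a b /=; rewrite mul0r addr0. Qed.

Lemma admissible_Re f z : continuous (f : C^o -> C^o) -> admissible (fun t => complex.Re (f (z / t%:C))).
Proof.
move=> cf; exact: (@admissible_path _ (fun w => complex.Re (f w)) z 
  (continuous_funcomp cf (@continuous_Re R))).
Qed.

Lemma admissible_Im f z : continuous (f : C^o -> C^o) -> admissible (fun t => complex.Im (f (z / t%:C))).
Proof.
move=> cf; exact: (@admissible_path _ (fun w => complex.Im (f w)) z 
  (continuous_funcomp cf (@continuous_Im R))).
Qed.

Lemma HausdorffE f z : continuous (f : C^o -> C^o) ->
  Hausdorff mu f z = W (fun t => complex.Re (f (z / t%:C))) +i*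
                     W (fun t => complex.Im (f (z / t%:C))).
Proof.
move=> cf; have [_ hr] := wint_halfline (admissible_Re z cf).
have [_ hi] := wint_halfline (admissible_Im z cf).
rewrite /Hausdorff -hr -hi; congr (_ +i* _); congr fine; apply: eq_integral => t _.
  by rewrite Re_integrand.
by rewrite Im_integrand.
Qed.

Lemma Hausdorff_defined_continuous f : continuous (f : C^o -> C^o) -> Hausdorff_defined mu f.
Proof.
move=> cf z; have [hr _] := wint_halfline (admissible_Re z cf).
have [hi _] := wint_halfline (admissible_Im z cf); split.
  rewrite (_ : (fun t => _) = EFin \o (fun t => t^-1 * complex.Re (f (z / t%:C))))//.
  by apply/funext => t; rewrite /= Re_integrand.
rewrite (_ : (fun t => _) = EFin \o (fun t => t^-1 * complex.Im (f (z / t%:C))))//.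
by apply/funext => t; rewrite /= Im_integrand.
Qed.

Lemma normc_Hausdorff_le f z (n : R -> R) : continuous (f : C^o -> C^o) -> admissible n ->
  (forall t, 1 <= t -> normc (f (z / t%:C)) <= n t) -> normc (Hausdorff mu f z) <= W n.
Proof.
move=> cf wn h; rewrite HausdorffE//; apply: (wint_normc mufin (admissible_Re z cf) (admissible_Im z cf) wn).
by move=> t t1; apply: le_trans (h t t1); case: (f _).
Qed.

Lemma Hausdorff_linear (a : C) f g z : continuous (f : C^o -> C^o) ->
  continuous (g : C^o -> C^o) ->
  Hausdorff mu (fun w => a * f w + g w) z = a * Hausdorff mu f z + Hausdorff mu g z.
Proof.
move=> cf cg; have caf : continuous ((fun w => a * f w + g w) : C^o -> C^o).
  have caf : continuous ((fun w => a * f w) : C^o -> C^o).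
    exact: (continuous_funcomp cf (@mulrl_continuous C a)).
  move=> w; exact: (@cvgD _ C^o _ _ _ _ _ _ _ (caf w) (cg w)).
rewrite !HausdorffE//; set fr := fun t => complex.Re (f _); set fi := fun t => complex.Im (f _).
set gr := fun t => complex.Re (g _); set gi := fun t => complex.Im (g _).
have [wfr wfi] : admissible fr /\ admissible fi by split; [exact: admissible_Re|exact: admissible_Im].
have [wgr wgi] : admissible gr /\ admissible gi by split; [exact: admissible_Re|exact: admissible_Im].
case: a caf => a1 a2 caf.
have -> : (fun t => complex.Re ((a1 +i* a2) * f (z / t%:C) + g (z / t%:C))) =
    (fun t => (a1 * fr t + - a2 * fi t) + gr t).
  apply/funext => t; rewrite /fr /fi /gr; case: (f _) => x y; case: (g _) => u v /=.
  by rewrite mulNr.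
have -> : (fun t => complex.Im ((a1 +i* a2) * f (z / t%:C) + g (z / t%:C))) =
    (fun t => (a1 * fi t + a2 * fr t) + gi t).
  by apply/funext => t; rewrite /fr /fi /gi; case: (f _) => x y; case: (g _) => u v.
have w1 := admissibleZ a1 wfr; have w2 := admissibleZ (- a2) wfi.
have w3 := admissibleZ a1 wfi; have w4 := admissibleZ a2 wfr.
rewrite (wintD mufin (admissibleD w1 w2) wgr) (wintD mufin w1 w2).
rewrite (wintD mufin (admissibleD w3 w4) wgi) (wintD mufin w3 w4).
rewrite (wintZ mufin a1 wfr) (wintZ mufin (- a2) wfi).
rewrite (wintZ mufin a1 wfi) (wintZ mufin a2 wfr) mulNr.
by [].
Qed.

(** The quadratic error of [f], uniform on a disc containing every point [z / t],
    integrates to a quadratic error for the transform. *)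
Lemma Hausdorff_entire f : entire f -> entire (Hausdorff mu f).
Proof.
move=> ef z; have cf := entire_continuous ef.
have [f' cf' quad] := entire_quadratic ef.
have [K K0 hK] := quad (normc z).
pose fr t := t^-1 * complex.Re (f' (z / t%:C)); pose fi t := t^-1 * complex.Im (f' (z / t%:C)).
have wfr : admissible fr := admissibleM (@admissible_inv R) (admissible_Re z cf').
have wfi : admissible fi := admissibleM (@admissible_inv R) (admissible_Im z cf').
apply/derivableCP; exists (W fr +i* W fi) => e e0.
have c0 : 0 <= c := wmass_ge0 mu.
have A0 : 0 < K * c + 1 by rewrite ltr_wpDl// mulr_ge0.
exists (Num.min 1 (e / (K * c + 1))); first by rewrite lt_min ltr01 divr_gt0.
move=> h; rewrite lt_min => /andP[h1 he].
have step : normc (Hausdorff mu f (z + h) - Hausdorff mu f z - (W fr +i* W fi) * h) <=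
    K * normc h ^+ 2 * c.
  have [w1 w2] := (admissible_Re (z + h) cf, admissible_Re z cf).
  have [w3 w4] := (admissible_Im (z + h) cf, admissible_Im z cf).
  rewrite !HausdorffE//; case: h h1 he w1 w3 => x y h1 he w1 w3.
  pose a t := (complex.Re (f ((z + (x +i* y)) / t%:C)) + - 1 * complex.Re (f (z / t%:C))) +
              (- x * fr t + y * fi t).
  pose b t := (complex.Im (f ((z + (x +i* y)) / t%:C)) + - 1 * complex.Im (f (z / t%:C))) +
              (- y * fr t + - x * fi t).
  have wa1 := admissibleD w1 (admissibleZ (- 1) w2).
  have wa2 := admissibleD (admissibleZ (- x) wfr) (admissibleZ y wfi).
  have wb1 := admissibleD w3 (admissibleZ (- 1) w4).
  have wb2 := admissibleD (admissibleZ (- y) wfr) (admissibleZ (- x) wfi).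
  have wa : admissible a := admissibleD wa1 wa2; have wb : admissible b := admissibleD wb1 wb2.
  set T := _ - _ - _.
  have -> : T = W a +i* W b.
    rewrite /T (wintD mufin wa1 wa2) (wintD mufin w1 (admissibleZ (- 1) w2)).
    rewrite (wintD mufin (admissibleZ (- x) wfr) (admissibleZ y wfi)).
    rewrite (wintD mufin wb1 wb2) (wintD mufin w3 (admissibleZ (- 1) w4)).
    rewrite (wintD mufin (admissibleZ (- y) wfr) (admissibleZ (- x) wfi)).
    rewrite (wintZ mufin (- 1) w2) (wintZ mufin (- 1) w4) (wintZ mufin (- x) wfr).
    rewrite (wintZ mufin y wfi) (wintZ mufin (- y) wfr) (wintZ mufin (- x) wfi).
    by apply/eqP; rewrite eq_complex /=; apply/andP; split; apply/eqP; ring.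
  rewrite -(wint_cst mufin).
  apply: (wint_normc mufin wa wb (admissible_cst _)) => t t1.
  have t0 : 0 < t := lt_le_trans ltr01 t1.
  have := hK (z / t%:C) ((x +i* y) / t%:C) (normc_div_le z t1)
    (le_trans (normc_div_le _ t1) (ltW h1)).
  rewrite -mulrDl => hq.
  have -> : a t +i* b t = f ((z + (x +i* y)) / t%:C) - f (z / t%:C) -
      f' (z / t%:C) * ((x +i* y) / t%:C).
    rewrite /a /b /fr /fi (divC_real (x +i* y)) /=.
    case: (f _) => p1 p2; case: (f _) => q1 q2; case: (f' _) => r1 r2.
    by apply/eqP; rewrite eq_complex /=; apply/andP; split; apply/eqP; ring.
  apply: le_trans hq _; apply: ler_wpM2l => //.
  by rewrite ler_sqr ?nnegrE ?normc_ge0//; exact: normc_div_le.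
apply: le_trans step _; rewrite expr2 mulrA mulrAC.
apply: ler_wpM2r; first exact: normc_ge0.
have n0 := normc_ge0 h.
move: he; rewrite ltr_pdivlMr// => he; rewrite mulrAC; lra.
Qed.

(** Jensen bounds each term by a weighted integral over [t]; summing over the vertices
    puts a mean of [f] at [z / t] under the integral sign. Since [z / t] lies in the
    disc through [z], that mean is bounded by the hypothesis. *)
Lemma node_mean_Hausdorff f (s : R) N z (M : R) : 1 <= s -> entire f ->
  (forall w, normc w <= normc z -> node_mean f s N w <= M) ->
  node_mean (Hausdorff mu f) s N z <= c `^ s * M.
Proof.
move=> s1 ef fM; have s0 : 0 < s := lt_le_trans ltr01 s1.
have cf := entire_continuous ef; have c0 : 0 <= c := wmass_ge0 mu.
have cn : continuous (fun w : C^o => normc (f w)) := continuous_funcomp cf (@continuous_normc R).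
pose n (k : nat) t := normc (f (root_node N k * z / t%:C)).
have wn k : admissible (n k) := @admissible_path _ (fun w => normc (f w)) _ cn.
have wns k : admissible (fun t => n k t `^ s) :=
  @admissible_path _ (fun w => normc (f w) `^ s) _ (continuous_powR_normc s0 cf).
have one k : normc (Hausdorff mu f (root_node N k * z)) `^ s <=
    c `^ (s - 1) * W (fun t => n k t `^ s).
  have Hn : normc (Hausdorff mu f (root_node N k * z)) <= W (n k).
    exact: normc_Hausdorff_le.
  have n0 t : 1 <= t -> 0 <= n k t by move=> _; exact: normc_ge0.
  apply: le_trans _ (wint_powR mufin s1 (wn k) (wns k) n0).
  by apply: (ge0_ler_powR (ltW s0) _ _ Hn);
    rewrite nnegrE ?normc_ge0// (le_trans (normc_ge0 _) Hn).
have [wsum sumE] := @wint_sum R mu mufin N (fun k t => n k t `^ s) wns.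
have -> : c `^ s * M = c `^ (s - 1) * (M * c).
  by rewrite -(mulr_powRB1 c0 s0) [c * _]mulrC -mulrA [c * M]mulrC.
apply: (@le_trans _ _ (N%:R^-1 * (\sum_(k < N) c `^ (s - 1) * W (fun t => n k t `^ s)))).
  apply: ler_wpM2l; first by rewrite invr_ge0.
  by apply: ler_sum => k _; exact: one.
rewrite -mulr_sumr -sumE mulrCA; apply: ler_wpM2l; first exact: powR_ge0.
rewrite -(wintZ mufin _ wsum) -(wint_cst mufin).
apply: (wint_le mufin (admissibleZ _ wsum) (admissible_cst M)) => t t1.
have := fM (z / t%:C) (normc_div_le z t1); apply: le_trans.
by apply/eq_ler; congr (_ * _); apply: eq_bigr => k _; rewrite /n mulrA.
Qed.

Lemma circle_mean_Hausdorff f (s r : R) : 1 <= s -> 0 <= r -> entire f ->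
  circle_mean (Hausdorff mu f) s r <= c `^ s * circle_mean f s r.
Proof.
move=> s1 r0 ef; have s0 : 0 < s := lt_le_trans ltr01 s1.
have cH := entire_continuous (Hausdorff_entire ef).
apply: (circle_mean_le s0 r0 (powR_ge0 _ _) (entire_continuous ef) cH) => N M _ fM.
apply: node_mean_Hausdorff => // w; rewrite normc_circle ger0_norm// => wr.
exact: (node_mean_max s1 ef fM wr).
Qed.

Lemma Hausdorff_circle_bound f (r M : R) : 0 <= r -> entire f ->
  (forall w, normc w = r -> normc (f w) <= M) ->
  forall z, normc z = r -> normc (Hausdorff mu f z) <= c * M.
Proof.
move=> r0 ef fM z zr; rewrite mulrC -(wint_cst mufin).
apply: normc_Hausdorff_le; [exact: entire_continuous|exact: admissible_cst|].
move=> t t1; apply: (maximum_principle (submean_normc_entire ef) fM).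
by rewrite -zr; exact: normc_div_le.
Qed.

End HausdorffOperator.

(** * Mixed norms *)

Section FockNorms.
Context {R : realType}.
Local Open Scope complex_scope.
Local Notation C := R[i].
Local Notation normc := (@Normc.normc R).
Local Notation leb := (@lebesgue_measure R).
Implicit Types (z w h : C) (f g : C -> C) (p q : \bar R) (phi : R -> R).

Lemma Mmean_EFin f (s r : R) : 0 < s -> continuous (f : C^o -> C^o) ->
  Mmean s%:E f r = (circle_mean f s r `^ s^-1)%:E.
Proof.
move=> s0 cf; have ig := continuous_itv_integrable 0 (2 * pi) (@continuous_circle_powR _ f s r s0 cf).
rewrite /Mmean -poweR_EFin /circle_mean circle_avg.unlock EFinM; congr ((_ * _) `^ _)%E.
by rewrite /Rintegral fineK//; exact: integrable_fin_num ig.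
Qed.

Lemma circle_mean_ge0 f (s r : R) : 0 < s -> continuous (f : C^o -> C^o) ->
  0 <= circle_mean f s r.
Proof.
move=> s0 cf; rewrite -[leLHS]circle_avg_cst; apply: le_circle_avg.
- exact: cst_continuous.
- exact: continuous_circle_powR.
- by move=> t; exact: powR_ge0.
Qed.

(** Characterizing the supremum by its upper bounds turns inequalities between suprema
    into statements about pointwise bounds. *)
Lemma Mmean_sup f (r : R) : 0 <= r -> entire f -> exists M : R,
  [/\ 0 <= M, Mmean +oo%E f r = M%:E &
      forall B : R, (forall z, normc z = r -> normc (f z) <= B) <-> M <= B].
Proof.
move=> r0 ef; have [B B0 fB] := entire_bounded r ef.
set S := [set (normc (f z))%:E | z in [set z | normc z = r]].
have nr : normc (circle_point r 0) = r by rewrite normc_circle ger0_norm.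
have SB : (ereal_sup S <= B%:E)%E.
  by apply: ge_ereal_sup => _ [z /= zr <-]; rewrite lee_fin fB// zr.
have S0 : ((normc (f (circle_point r 0)))%:E <= ereal_sup S)%E.
  by apply: ereal_sup_ubound; exists (circle_point r 0).
have Sfin : ereal_sup S \is a fin_num.
  rewrite fin_numE; apply/andP; split.
    by apply: contraTneq S0 => ->; rewrite leeNy_eq.
  by apply: contraTneq SB => ->; rewrite leye_eq.
exists (fine (ereal_sup S)); split.
- by rewrite -lee_fin fineK// (le_trans _ S0)// lee_fin normc_ge0.
- by rewrite fineK.
- move=> B'; split=> [h|SB' z zr].
    by rewrite -lee_fin fineK//; apply: ge_ereal_sup => _ [z /= zr <-]; rewrite lee_fin h.
  rewrite -lee_fin (le_trans (y := ereal_sup S))//; last by rewrite -[leLHS]fineK.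
  by apply: ereal_sup_ubound; exists z.
Qed.

Lemma lee1_cases p : (1 <= p)%E -> p = +oo%E \/ exists2 s : R, 1 <= s & p = s%:E.
Proof.
case: p => [s s1| _|//]; last by left.
by right; exists s => //; rewrite -lee_fin.
Qed.

Lemma Mmean_fine p f (r : R) : (1 <= p)%E -> 0 <= r -> entire f ->
  Mmean p f r = (fine (Mmean p f r))%:E /\ 0 <= fine (Mmean p f r).
Proof.
move=> /lee1_cases[->|[s s1 ->]] r0 ef.
  by have [M [M0 -> _]] := Mmean_sup r0 ef.
have s0 : 0 < s := lt_le_trans ltr01 s1.
by rewrite (Mmean_EFin r s0 (entire_continuous ef)) /=; split => //; exact: powR_ge0.
Qed.

Lemma Mmean_mono p f (r1 r2 : R) : (1 <= p)%E -> 0 <= r1 -> r1 <= r2 -> entire f ->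
  fine (Mmean p f r1) <= fine (Mmean p f r2).
Proof.
move=> /lee1_cases[->|[s s1 ->]] r10 r12 ef.
  have [M1 [_ -> h1]] := Mmean_sup r10 ef.
  have [M2 [_ -> h2]] := Mmean_sup (le_trans r10 r12) ef.
  apply/h1 => z zr; apply: (maximum_principle (submean_normc_entire ef) ((h2 M2).2 (lexx _))).
  by rewrite zr.
have s0 : 0 < s := lt_le_trans ltr01 s1; have cf := entire_continuous ef.
rewrite !(Mmean_EFin _ s0 cf)/= ge0_ler_powR ?invr_ge0 ?(ltW s0) ?nnegrE ?circle_mean_ge0//.
exact: circle_mean_mono.
Qed.

(** Domination for all exponents at once, with factor [k]: the first clause serves the
    finite exponents, the second the infinite one. *)
Definition mean_dominated g f (k r : R) :=
  (forall s, 1 <= s -> circle_mean g s r <= k `^ s * circle_mean f s r) /\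
  (forall M, (forall w, normc w = r -> normc (f w) <= M) ->
     forall z, normc z = r -> normc (g z) <= k * M).

Lemma Mmean_le p f g (k r : R) : (1 <= p)%E -> 0 <= k -> 0 <= r ->
  entire f -> entire g -> mean_dominated g f k r ->
  (Mmean p g r <= k%:E * Mmean p f r)%E.
Proof.
move=> /lee1_cases[->|[s s1 ->]] k0 r0 ef eg [h1 h2].
  have [Mf [_ -> hf]] := Mmean_sup r0 ef; have [Mg [_ -> hg]] := Mmean_sup r0 eg.
  by rewrite -EFinM lee_fin; apply/hg/h2/hf.
have s0 : 0 < s := lt_le_trans ltr01 s1.
have [cf cg] := (entire_continuous ef, entire_continuous eg).
rewrite !Mmean_EFin// -EFinM lee_fin.
have -> : k * circle_mean f s r `^ s^-1 = (k `^ s * circle_mean f s r) `^ s^-1.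
  by rewrite powRM ?powR_ge0 ?circle_mean_ge0// -powRrM mulfV ?gt_eqF// powRr1.
apply: ge0_ler_powR; rewrite ?invr_ge0 ?(ltW s0) ?nnegrE ?mulr_ge0 ?powR_ge0 ?circle_mean_ge0//.
exact: h1.
Qed.

(** Monotonicity in the radius provides measurability; composing with the maximum with
    zero makes it global. *)
Lemma Mmean_measurable p f : (1 <= p)%E -> entire f ->
  measurable_fun (`[0, +oo[%classic : set R) (fun r => fine (Mmean p f r)).
Proof.
move=> p1 ef.
have mm : measurable_fun (`[0, +oo[%classic : set R) (fun r => fine (Mmean p f (Num.max r 0))).
  apply: nondecreasing_measurable => // r1 r2 r12.
  apply: Mmean_mono => //; first by rewrite le_max lexx orbT.
  by rewrite ge_max !le_max r12 lexx !orbT.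
apply: eq_measurable_fun mm => r.
by rewrite inE/= in_itv/= andbT => r0; rewrite max_l.
Qed.

(** A function differentiable on the closed half-line becomes continuous on the whole
    line once it is extended by its value at the origin. *)
Lemma C1_halfline_continuous phi : C1_halfline phi ->
  continuous (fun r : R => phi (Num.max r 0)).
Proof.
move=> [dphi [_ hd]] x.
set x0 := Num.max x 0; have x00 : 0 <= x0 by rewrite le_max lexx orbT.
have maxd y : `|Num.max y 0 - x0| <= `|y - x|.
  rewrite /x0; have [y0|y0] := leP 0 y; have [xx|xx] := leP 0 x; rewrite ?subrr ?normr0//.
  - by rewrite subr0 ger0_norm// ger0_norm; lra.
  - by rewrite sub0r normrN ger0_norm// ler0_norm; lra.
have /cvgrPdist_lt/(_ _ ltr01) := hd x0 x00.
rewrite /within/= => /nbhs_ballP[del/= del0 hdel].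
apply/cvgrPdist_lt => e e0.
have d0 : 0 < `|dphi x0| + 1 by rewrite ltr_wpDl.
apply/nbhs_ballP; exists (Num.min del (e / (`|dphi x0| + 1))).
  by rewrite /= lt_min del0 divr_gt0.
move=> y; rewrite /ball/= lt_min => /andP[yd ye]; rewrite -/x0.
set y0 := Num.max y 0; have y00 : 0 <= y0 by rewrite le_max lexx orbT.
have yx : `|y0 - x0| <= `|x - y| by rewrite [leRHS]distrC; exact: maxd.
have [->|yx0] := eqVneq y0 x0; first by rewrite subrr normr0.
have := hdel y0; rewrite /ball/= distrC => /(_ (le_lt_trans yx yd) yx0).
rewrite in_itv/= andbT => /(_ y00) hq.
have n0 : 0 < `|y0 - x0| by rewrite normr_gt0 subr_eq0.
have q1 : `|(phi y0 - phi x0) / (y0 - x0)| < `|dphi x0| + 1.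
  rewrite -[X in `|X|](subrK (dphi x0)) addrC; apply: le_lt_trans (ler_normD _ _) _.
  by rewrite ltrD2l distrC.
rewrite distrC; move: q1; rewrite normrM normfV ltr_pdivrMr// => /lt_le_trans; apply.
rewrite mulrC -ler_pdivlMr//; apply: le_trans yx _; exact: ltW.
Qed.

Lemma C1_halfline_measurable phi : C1_halfline phi ->
  measurable_fun (`[0, +oo[%classic : set R) phi.
Proof.
move=> hphi.
have mm : measurable_fun (`[0, +oo[%classic : set R) (fun r => phi (Num.max r 0)).
  exact: measurable_funS (continuous_measurable_fun (C1_halfline_continuous hphi)).
apply: eq_measurable_fun mm => r.
by rewrite inE/= in_itv/= andbT => r0; rewrite max_l.
Qed.

Lemma Fock_norm_le p q phi f g (k : R) : (1 <= p)%E -> (1 <= q)%E ->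
  C1_halfline phi -> 0 <= k -> entire f -> entire g ->
  (forall r, 0 <= r -> (Mmean p g r <= k%:E * Mmean p f r)%E) ->
  (Fock_norm p q phi g <= k%:E * Fock_norm p q phi f)%E.
Proof.
move=> p1 /lee1_cases[->|[s s1 ->]] hphi k0 ef eg h; rewrite /Fock_norm.
  apply: ge_ereal_sup => _ [r /= r0 <-]; rewrite in_itv/= andbT in r0.
  have e0 : (0 <= (expR (- phi r))%:E :> \bar R)%E by rewrite lee_fin expR_ge0.
  apply: le_trans (lee_wpmul2r e0 (h r r0)) _; rewrite -muleA.
  apply: lee_wpmul2l; first by rewrite lee_fin.
  by apply: ereal_sup_ubound; exists r; rewrite //= in_itv/= r0.
have s0 : 0 < s := lt_le_trans ltr01 s1.
pose wt r := expR (- (s * phi r)) * r.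
have mphi := C1_halfline_measurable hphi.
have mwt : measurable_fun (`[0, +oo[%classic : set R) wt.
  apply: measurable_funM => //; apply: measurableT_comp => //.
  by apply: measurableT_comp => //; exact: measurable_funM.
have wt0 r : 0 <= r -> 0 <= wt r by move=> r0; rewrite mulr_ge0// expR_ge0.
pose J u r := (fine (Mmean p u r) `^ s * wt r)%:E.
have JE u : entire u -> (\int[leb]_(r in `[0%R, +oo[) ((Mmean p u r) `^ s *
    (expR (- (s * phi r)) * r)%:E) = \int[leb]_(r in `[0%R, +oo[) J u r)%E.
  move=> eu; apply: eq_integral => r; rewrite inE/= in_itv/= andbT => r0.
  by have [E _] := Mmean_fine p1 r0 eu; rewrite [in LHS]E poweR_EFin -EFinM.
have mJ u : entire u -> measurable_fun (`[0, +oo[%classic : set R) (J u).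
  move=> eu; apply/measurable_EFinP; apply: measurable_funM => //.
  exact: (measurableT_comp (@measurable_powR R s) (Mmean_measurable p1 eu)).
have J0 u r : `[0, +oo[%classic r -> (0 <= J u r)%E.
  by rewrite /= in_itv/= andbT => r0; rewrite lee_fin mulr_ge0 ?powR_ge0 ?wt0.
rewrite (JE _ ef) (JE _ eg).
have ks0 : (0 <= (k `^ s)%:E :> \bar R)%E by rewrite lee_fin powR_ge0.
have kE : k%:E = (((k `^ s)%:E) `^ s^-1)%E.
  by rewrite poweR_EFin -powRrM mulfV ?gt_eqF// powRr1.
rewrite kE -poweRM//; last by apply: integral_ge0 => r; exact: J0.
apply: gt0_ler_poweR; first by rewrite invr_ge0 ltW.
- by rewrite in_itv/= leey andbT; apply: integral_ge0 => r; exact: J0.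
- rewrite in_itv/= leey andbT; apply: mule_ge0 => //.
  by apply: integral_ge0 => r; exact: J0.
have EZ : (\int[leb]_(r in `[0%R, +oo[) ((k `^ s)%:E * J f r) =
    (k `^ s)%:E * \int[leb]_(r in `[0%R, +oo[) J f r)%E.
  by apply: ge0_integralZl => //; [exact: mJ|move=> r; exact: J0].
rewrite -EZ; apply: ge0_le_integral => //.
- by move=> r; exact: J0.
- exact: mJ.
- by apply: measurable_funeM; exact: mJ.
- move=> r; rewrite /= in_itv/= andbT => r0.
  have [Ef Mf0] := Mmean_fine p1 r0 ef; have [Eg Mg0] := Mmean_fine p1 r0 eg.
  have hM : fine (Mmean p g r) <= k * fine (Mmean p f r).
    by have := h r r0; rewrite {1}Ef {1}Eg -EFinM lee_fin.
  rewrite /J -EFinM lee_fin [leRHS]mulrA; apply: ler_wpM2r; first exact: wt0.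
  by rewrite -powRM//; apply: ge0_ler_powR; rewrite ?(ltW s0) ?nnegrE ?mulr_ge0.
Qed.

End FockNorms.

(** * Homogeneity and positivity of the norms *)

Section TestFunctions.
Context {R : realType}.
Local Open Scope complex_scope.
Local Notation C := R[i].
Local Notation normc := (@Normc.normc R).
Local Notation leb := (@lebesgue_measure R).
Implicit Types (z w h : C) (f g : C -> C) (p q : \bar R) (phi : R -> R).

Lemma normc_real (k : R) : 0 <= k -> normc k%:C = k.
Proof. by move=> k0; rewrite /= expr0n/= addr0 sqrtr_sqr ger0_norm. Qed.

Lemma mean_dominated_scale f (k r : R) : 0 <= k -> continuous (f : C^o -> C^o) ->
  mean_dominated (fun z => k%:C * f z) f k r.
Proof.
move=> k0 cf; split=> [s s1|M fM z zr]; last first.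
  by rewrite Normc.normcM normc_real// ler_wpM2l// fM.
have s0 : 0 < s := lt_le_trans ltr01 s1.
rewrite /circle_mean -(circle_avgZ _ (continuous_circle_powR s0 cf)).
rewrite (_ : (fun t => _) = (fun t => k `^ s * normc (f (circle_point r t)) `^ s))//.
by apply/funext => t; rewrite Normc.normcM normc_real// powRM// normc_ge0.
Qed.

Lemma Fock_norm_scale p q phi f (k : R) : (1 <= p)%E -> (1 <= q)%E ->
  C1_halfline phi -> 0 < k -> entire f ->
  Fock_norm p q phi (fun z => k%:C * f z) = (k%:E * Fock_norm p q phi f)%E.
Proof.
move=> p1 q1 hphi k0 ef; have ekf : entire (fun z => k%:C * f z) := @entireZ R k%:C f ef.
apply/le_anti/andP; split.
  apply: Fock_norm_le => //; first exact: ltW.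
  move=> r r0; apply: Mmean_le => //; first exact: ltW.
  by apply: mean_dominated_scale; [exact: ltW|exact: entire_continuous].
have ki0 : 0 < k^-1 by rewrite invr_gt0.
rewrite -lee_pdivlMl//; apply: Fock_norm_le => //; first exact: ltW.
move=> r r0; apply: Mmean_le => //; first exact: ltW.
have := @mean_dominated_scale (fun z => k%:C * f z) k^-1 r (ltW ki0) (entire_continuous ekf).
rewrite (_ : (fun z => (k^-1)%:C * (k%:C * f z)) = f)//.
by apply/funext => z; rewrite mulrA -rmorphM/= mulVf ?gt_eqF// mul1r.
Qed.

Lemma Fock_norm_ge0 p q phi f : (1 <= p)%E -> (1 <= q)%E -> entire f ->
  (0 <= Fock_norm p q phi f)%E.
Proof.
move=> p1 /lee1_cases[->|[s s1 ->]] ef; last exact: poweR_ge0.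
apply: (@le_trans _ _ (Mmean p f 0 * (expR (- phi 0))%:E)%E).
  by have [-> M0] := Mmean_fine p1 (lexx 0) ef; rewrite -EFinM lee_fin mulr_ge0 ?expR_ge0.
by apply: ereal_sup_ubound; exists 0; rewrite //= in_itv/= lexx.
Qed.

(** The mean at radius one bounds those at larger radii from below, and the weight is
    bounded on the segment from 1 to 2. *)
Lemma Fock_norm_gt0 p q phi f : (1 <= p)%E -> (1 <= q)%E -> C1_halfline phi ->
  entire f -> 0 < fine (Mmean p f 1) -> (0 < Fock_norm p q phi f)%E.
Proof.
move=> p1 /lee1_cases[->|[s s1 ->]] hphi ef M0.
  apply: (@lt_le_trans _ _ (Mmean p f 1 * (expR (- phi 1))%:E)%E).
    have [-> _] := Mmean_fine p1 ler01 ef.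
    by rewrite -EFinM lte_fin mulr_gt0// expR_gt0.
  by apply: ereal_sup_ubound; exists 1; rewrite //= in_itv/= ler01.
have s0 : 0 < s := lt_le_trans ltr01 s1.
apply: poweR_gt0; set m := fine _ in M0.
have cphi := C1_halfline_continuous hphi.
have [|c _ hc] := @EVT_max R (fun r => phi (Num.max r 0)) 1 2 _ (continuous_subspaceT cphi).
  by rewrite ler1n.
set B := phi (Num.max c 0) in hc.
pose k : R := m `^ s * expR (- (s * B)).
have k0 : 0 < k by rewrite mulr_gt0 ?powR_gt0 ?expR_gt0.
have mphi := C1_halfline_measurable hphi.
have mg : measurable_fun (`[0, +oo[%classic : set R)
    (fun r => ((Mmean p f r) `^ s * (expR (- (s * phi r)) * r)%:E)%E).
  have mr : measurable_fun (`[0, +oo[%classic : set R)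
      (fun r => (fine (Mmean p f r) `^ s * (expR (- (s * phi r)) * r))%:E).
    apply/measurable_EFinP; apply: measurable_funM => //.
      exact: (measurableT_comp (@measurable_powR R s) (Mmean_measurable p1 ef)).
    apply: measurable_funM => //; apply: measurableT_comp => //.
    by apply: measurableT_comp => //; exact: measurable_funM.
  apply: eq_measurable_fun mr => r; rewrite inE/= in_itv/= andbT => r0.
  by have [E _] := Mmean_fine p1 r0 ef; rewrite [in RHS]E poweR_EFin -EFinM.
have g0 r : `[0, +oo[%classic r -> (0 <= (Mmean p f r) `^ s * (expR (- (s * phi r)) * r)%:E)%E.
  rewrite /= in_itv/= andbT => r0; apply: mule_ge0; first exact: poweR_ge0.
  by rewrite lee_fin mulr_ge0// expR_ge0.
have s12 : `[1, 2]%classic `<=` (`[0, +oo[%classic : set R).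
  by move=> r /=; rewrite !in_itv/= andbT => /andP[r1 _]; exact: le_trans r1.
apply: (@lt_le_trans _ _ (\int[leb]_(r in `[1%R, 2%R]) k%:E)%E).
  rewrite integral_cst//= lebesgue_measure_itv/= lte_fin ltr1n/= -EFinB -EFinM lte_fin.
  by rewrite mulr_gt0// subr_gt0 ltr1n.
apply: (@le_trans _ _ (\int[leb]_(r in `[1%R, 2%R])
    ((Mmean p f r) `^ s * (expR (- (s * phi r)) * r)%:E))%E); last first.
  exact: ge0_subset_integral.
apply: ge0_le_integral => //.
- by move=> r _; rewrite lee_fin ltW.
- exact: measurable_funS mg.
- move=> r /=; rewrite in_itv/= => /andP[r1 r2].
  have r0 : 0 <= r := le_trans ler01 r1.
  have [E Mr0] := Mmean_fine p1 r0 ef; rewrite E poweR_EFin -EFinM lee_fin /k.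
  have phiB : phi r <= B.
    by have := hc r; rewrite in_itv/= r1 r2 max_l// => /(_ isT).
  apply: ler_pM; rewrite ?powR_ge0 ?expR_ge0//.
    by apply: ge0_ler_powR; rewrite ?(ltW s0) ?nnegrE ?(ltW M0)//; exact: Mmean_mono.
  rewrite -[leLHS]mulr1; apply: ler_pM; rewrite ?expR_ge0//.
  by rewrite ler_expR lerN2 ler_pM2l.
Qed.

Lemma Mmean_monomial p n : (1 <= p)%E -> entire (fun z => z ^+ n) ->
  0 < fine (Mmean p (fun z => z ^+ n) 1).
Proof.
move=> p1 en; have n1 z : normc z = 1 -> normc (z ^+ n) = 1.
  by move=> z1; elim: n {en} => [|n IH]; rewrite ?expr0 ?Normc.normc1// exprS Normc.normcM IH z1 mulr1.
have c1 t : normc (circle_point 1 t) = 1 by rewrite normc_circle normr1.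
have [->|[s s1 ->]] := lee1_cases p1.
  have [M [M0 -> h]] := Mmean_sup ler01 en.
  by apply: (@lt_le_trans _ _ 1) => //; have := (h M).2 (lexx _) _ (c1 0); rewrite (n1 _ (c1 0)).
rewrite (Mmean_EFin _ (lt_le_trans ltr01 s1) (entire_continuous en)).
rewrite /circle_mean (_ : (fun t => _) = fun=> 1) ?circle_avg_cst ?powR1//=.
by apply/funext => t; rewrite n1// powR1.
Qed.

End TestFunctions.

(** * Monomials and moments *)

Section Necessity.
Context {R : realType} (mu : {measure set (measurableTypeR R) -> \bar R}).
Local Open Scope complex_scope.
Local Notation C := R[i].
Implicit Types (z : C) (p q : \bar R) (phi : R -> R).

Definition moment (n : nat) : R := \int[mu]_(t in `]0%R, +oo[) (t^-1 ^+ n.+1).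

Lemma monomial_integrand n z (t : R) :
  Hausdorff_integrand (fun z => z ^+ n) z t = (t^-1 ^+ n.+1)%:C * z ^+ n.
Proof.
by rewrite /Hausdorff_integrand -fmorphV/= exprMn -rmorphXn/= mulrC -mulrA -rmorphM/= mulrC exprSr.
Qed.

Lemma moment_integrable n : Hausdorff_defined mu (fun z => z ^+ n) ->
  mu.-integrable `]0%R, +oo[ (EFin \o (fun t => t^-1 ^+ n.+1)).
Proof.
move=> /(_ 1)[+ _]; rewrite (_ : (fun t => _) = EFin \o (fun t => t^-1 ^+ n.+1))//.
by apply/funext => t; rewrite monomial_integrand expr1n mulr1.
Qed.

Lemma Hausdorff_monomial n : Hausdorff_defined mu (fun z => z ^+ n) ->
  Hausdorff mu (fun z => z ^+ n) = fun z => (moment n)%:C * z ^+ n.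
Proof.
move=> /moment_integrable hi; apply/funext => z; rewrite /Hausdorff.
have -> : \int[mu]_(t in `]0%R, +oo[) complex.Re (Hausdorff_integrand (fun z => z ^+ n) z t) =
    moment n * complex.Re (z ^+ n).
  rewrite -(RintegralZr _ _ hi)//; congr fine; apply: eq_integral => t _.
  by rewrite monomial_integrand; case: (z ^+ n) => a b /=; rewrite mul0r subr0.
have -> : \int[mu]_(t in `]0%R, +oo[) complex.Im (Hausdorff_integrand (fun z => z ^+ n) z t) =
    moment n * complex.Im (z ^+ n).
  rewrite -(RintegralZr _ _ hi)//; congr fine; apply: eq_integral => t _.
  by rewrite monomial_integrand; case: (z ^+ n) => a b /=; rewrite mul0r addr0.
by case: (z ^+ n) => a b /=; apply/eqP; rewrite eq_complex/= !mul0r subr0 addr0 !eqxx.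
Qed.

(** A mass in the interval from 0 to [d < 1] would make the moment of order [n] grow
    at least like the power [n + 1] of the inverse of [d]. *)
Lemma null_of_bounded_moments (B : R) :
  (forall n, mu.-integrable `]0%R, +oo[ (EFin \o (fun t => t^-1 ^+ n.+1))) ->
  (forall n, moment n <= B) -> mu [set` `]0%R, 1%R[] = 0%E.
Proof.
move=> hi hB.
have small (d : R) : 0 < d < 1 -> mu [set` `]0%R, d]] = 0%E.
  move=> /andP[d0 d1].
  have bnd n : ((d^-1 ^+ n.+1)%:E * mu [set` `]0%R, d]] <= B%:E)%E.
    apply: (@le_trans _ _ (moment n)%:E); last by rewrite lee_fin.
    rewrite /moment /Rintegral fineK; last exact: integrable_fin_num (hi n).
    rewrite -integral_cst//=.
    apply: (@le_trans _ _ (\int[mu]_(t in `]0%R, d]) (t^-1 ^+ n.+1)%:E)%E).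
      apply: ge0_le_integral => //.
      - by move=> t _; rewrite lee_fin exprn_ge0// invr_ge0 ltW.
      - apply: measurable_funS (measurable_int _ (hi n)) => //.
        by move=> t /=; rewrite !in_itv/= andbT => /andP[].
      - move=> t /=; rewrite in_itv/= => /andP[t0 td]; rewrite lee_fin.
        by rewrite lerXn2r ?nnegrE ?invr_ge0 ?(ltW t0) ?(ltW d0)// lef_pV2 ?posrE.
    apply: ge0_subset_integral => //.
    - exact: measurable_int (hi n).
    - by move=> t /=; rewrite in_itv/= andbT => t0; rewrite lee_fin exprn_ge0// invr_ge0 ltW.
    - by move=> t /=; rewrite !in_itv/= andbT => /andP[].
  have mle n : (mu [set` `]0%R, d]] <= (B * d ^+ n.+1)%:E)%E.
    have dn : 0 < d ^+ n.+1 by rewrite exprn_gt0.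
    by have := bnd n; rewrite exprVn lee_pdivrMl// -EFinM mulrC.
  have mfin : mu [set` `]0%R, d]] \is a fin_num.
    by rewrite ge0_fin_numE ?measure_ge0// (le_lt_trans (mle 0%N))// ltry.
  apply/le_anti; rewrite measure_ge0 andbT -(fineK mfin) lee_fin.
  apply/ler_addgt0Pr => e e0; rewrite add0r.
  have := @cvg_geometric R (B * d) d; rewrite ger0_norm ?(ltW d0)// => /(_ d1).
  move=> /cvgr0_norm_lt/(_ _ e0)[n _ /(_ n (leqnn n))]; rewrite /geometric/=.
  move=> /(le_lt_trans (ler_norm _))/ltW; apply: le_trans.
  by rewrite -mulrA -exprS -lee_fin fineK//; exact: mle.
have cover : [set` `]0%R, 1%R[] `<=` \bigcup_k [set` `]0%R, 1 - k.+2%:R^-1 :> R]].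
  move=> t /=; rewrite in_itv/= => /andP[t0 t1].
  have [k hk] : exists k : nat, (1 - t)^-1 < k%:R.
    exists (Num.bound (1 - t)^-1); rewrite archi_boundP// invr_ge0 subr_ge0 ltW//.
  exists k => //=; rewrite in_itv/= t0/= lerBrDr addrC -lerBrDr.
  have t1' : 0 < 1 - t by rewrite subr_gt0.
  rewrite -[leRHS]invrK lef_pV2 ?posrE ?invr_gt0//.
  by apply: le_trans (ltW hk) _; rewrite ler_nat -addn2 leq_addr.
apply: measure_negligible => //; apply: (@negligibleS _ _ _ mu _ _ cover).
apply: negligible_bigcup => k /=; apply/negligibleP => //; apply: small.
rewrite subr_gt0 invf_lt1 ?ltr1n//= ltrBlDr ltrDl invr_gt0 ltr0n.
Qed.

End Necessity.

(** * Boundedness and operator norm *)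

Section Boundedness.
Context {R : realType} (mu : {measure set (measurableTypeR R) -> \bar R}).
Context (p q : \bar R) (phi : R -> R).
Local Open Scope complex_scope.
Local Notation C := R[i].
Implicit Types (z : C) (f : C -> C).

Hypotheses (p1 : (1 <= p)%E) (q1 : (1 <= q)%E) (hphi : C1_halfline phi).

Lemma Fock_norm_Hausdorff f : mu [set` `]0%R, 1%R[] = 0%E ->
  (\int[mu]_(t in `]0%R, +oo[) (t^-1)%:E < +oo)%E -> entire f ->
  (Fock_norm p q phi (Hausdorff mu f) <= (wmass mu)%:E * Fock_norm p q phi f)%E.
Proof.
move=> mu01 mufin ef; have eH := Hausdorff_entire mu01 mufin ef.
have c0 := wmass_ge0 mu.
apply: (Fock_norm_le p1 q1 hphi c0 ef eH) => r r0.
apply: (Mmean_le p1 c0 r0 ef eH); split=> [s s1|M fM].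
  exact: circle_mean_Hausdorff.
exact: Hausdorff_circle_bound.
Qed.

Lemma Hausdorff_bounded_sufficient : mu [set` `]0%R, 1%R[] = 0%E ->
  (\int[mu]_(t in `]0%R, +oo[) (t^-1)%:E < +oo)%E -> Hausdorff_bounded mu p q phi.
Proof.
move=> mu01 mufin; split.
- move=> f [ef nf]; split.
    exact: (Hausdorff_defined_continuous mu01 mufin (entire_continuous ef)).
  split; first exact: Hausdorff_entire.
  apply: le_lt_trans (Fock_norm_Hausdorff mu01 mufin ef) _.
  by apply: lte_mul_pinfty => //; rewrite lee_fin; exact: wmass_ge0.
- move=> a f g [ef _] [eg _] z.
  exact: (Hausdorff_linear mu01 mufin a z (entire_continuous ef) (entire_continuous eg)).
- by exists (wmass mu) => f [ef _]; exact: Fock_norm_Hausdorff.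
Qed.

Hypothesis hpoly : forall n : nat, Fock p q phi (fun z => z ^+ n).

Lemma Fock_norm_monomial n : exists2 N : R, 0 < N &
  Fock_norm p q phi (fun z => z ^+ n) = N%:E.
Proof.
have [en nfin] := hpoly n.
have n0 := Fock_norm_gt0 p1 q1 hphi en (Mmean_monomial p1 en).
exists (fine (Fock_norm p q phi (fun z => z ^+ n))).
  by rewrite fine_gt0// n0 nfin.
by rewrite fineK// ge0_fin_numE// ltW.
Qed.

Lemma moment_le_bound (B : R) n : Hausdorff_bounded mu p q phi ->
  (forall f, Fock p q phi f ->
     (Fock_norm p q phi (Hausdorff mu f) <= B%:E * Fock_norm p q phi f)%E) ->
  moment mu n <= Num.max B 0.
Proof.
move=> [hd _ _] hB; have [dn _] := hd _ (hpoly n); have [en _] := hpoly n.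
have := hB _ (hpoly n); rewrite (Hausdorff_monomial dn).
have [m0|m0] := leP (moment mu n) 0; first by rewrite le_max m0 orbT.
have [N N0 NE] := Fock_norm_monomial n.
rewrite (Fock_norm_scale p1 q1 hphi m0 en) NE -!EFinM lee_fin ler_pM2r// => h.
by rewrite le_max h.
Qed.

Lemma Hausdorff_bounded_necessary : Hausdorff_bounded mu p q phi ->
  mu [set` `]0%R, 1%R[] = 0%E /\ (\int[mu]_(t in `]0%R, +oo[) (t^-1)%:E < +oo)%E.
Proof.
move=> hb; have [hd _ [B hB]] := hb.
have hi n := moment_integrable (hd _ (hpoly n)).1.
split; first by apply: null_of_bounded_moments hi _ => n; exact: moment_le_bound hb hB.
have -> : (fun t : R => (t^-1)%:E) = EFin \o (fun t => t^-1 ^+ 1).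
  by apply/funext => t; rewrite /= expr1.
by apply: integral_fune_lt_pinfty => //; exact: hi 0%N.
Qed.

Lemma wmassE : (\int[mu]_(t in `]0%R, +oo[) (t^-1)%:E < +oo)%E ->
  (\int[mu]_(t in `[1%R, +oo[) (t^-1)%:E)%E = (wmass mu)%:E.
Proof.
move=> mufin; have hi := wint_integrable mufin (admissible_cst 1).
rewrite /wmass /wint /Rintegral fineK; last exact: integrable_fin_num hi.
by apply: eq_integral => t _; rewrite mulr1.
Qed.

Lemma moment0E : mu [set` `]0%R, 1%R[] = 0%E ->
  (\int[mu]_(t in `]0%R, +oo[) (t^-1)%:E < +oo)%E -> moment mu 0 = wmass mu.
Proof.
move=> mu01 mufin; have [_ hE] := wint_halfline mu01 mufin (admissible_cst 1).
apply: etrans hE; apply: eq_Rintegral => t _.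
by rewrite expr1 mulr1.
Qed.

(** Constants are eigenvectors whose eigenvalue is the whole weighted mass. *)
Lemma Hausdorff_opnormE : Hausdorff_bounded mu p q phi ->
  Hausdorff_opnorm mu p q phi = (\int[mu]_(t in `[1%R, +oo[) (t^-1)%:E)%E.
Proof.
move=> hb; have [mu01 mufin] := Hausdorff_bounded_necessary hb.
rewrite (wmassE mufin); have c0 := wmass_ge0 mu.
apply/le_anti/andP; split.
  apply: ge_ereal_sup => _ [f [[ef _] f1] <-].
  apply: le_trans (Fock_norm_Hausdorff mu01 mufin ef) _.
  by rewrite -[leRHS]mule1; apply: lee_wpmul2l => //; rewrite lee_fin.
have [N N0 NE] := Fock_norm_monomial 0; have [e0 _] := hpoly 0%N.
have Ni0 : 0 < N^-1 by rewrite invr_gt0.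
pose f := fun z : C => (N^-1)%:C * z ^+ 0.
have nf : Fock_norm p q phi f = 1%E.
  by rewrite /f (Fock_norm_scale p1 q1 hphi Ni0 e0) NE -EFinM mulVf ?gt_eqF.
have ef : entire f := @entireZ R _ _ e0.
have Ff : Fock p q phi f by split=> //; rewrite nf ltry.
have Hf : Hausdorff mu f = fun z => (wmass mu)%:C * f z.
  apply/funext => z; have [hd _ _] := hb.
  have d0 := (hd _ (hpoly 0%N)).1.
  have cst0 : continuous ((fun _ : C => 0 : C) : C^o -> C^o) by exact: cst_continuous.
  have H0 : Hausdorff mu (fun _ : C => 0 : C) z = 0.
    have := Hausdorff_linear mu01 mufin (- 1) z cst0 cst0.
    have -> : (fun w : C => - 1 * 0 + 0 : C) = (fun _ : C => 0 : C).
      by apply/funext => w; rewrite mulr0 addr0.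
    by rewrite mulN1r addNr.
  have := Hausdorff_linear mu01 mufin (N^-1)%:C z (entire_continuous e0) cst0.
  have -> : (fun w : C => (N^-1)%:C * w ^+ 0 + 0) = f by apply/funext => w; rewrite addr0.
  by rewrite H0 addr0 (Hausdorff_monomial d0) (moment0E mu01 mufin) mulrCA.
apply: (@le_trans _ _ (Fock_norm p q phi (Hausdorff mu f))); last first.
  by apply: ereal_sup_ubound; exists f => //; split=> //; rewrite nf.
have [c00|cn] := eqVneq (wmass mu) 0.
  apply: (@le_trans _ _ 0%E); first by rewrite c00.
  exact: (Fock_norm_ge0 phi p1 q1 (Hausdorff_entire mu01 mufin ef)).
have cp : 0 < wmass mu by rewrite lt_neqAle eq_sym cn.
by rewrite Hf (Fock_norm_scale p1 q1 hphi cp ef) nf mule1.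
Qed.

End Boundedness.

Theorem theorem2 (R : realType) (p q : \bar R) (phi : R -> R)
    (mu : {measure set (measurableTypeR R) -> \bar R})
    (hp : (1 <= p)%E) (hq : (1 <= q)%E) (hphi : weight q phi)
    (hpoly : forall n : nat, Fock p q phi (fun z => z ^+ n)) :
  (Hausdorff_bounded mu p q phi <->
     mu [set` `]0%R, 1%R[] = 0%E /\
     (\int[mu]_(t in `]0%R, +oo[) (t^-1)%:E < +oo)%E) /\
  (Hausdorff_bounded mu p q phi ->
     Hausdorff_opnorm mu p q phi = \int[mu]_(t in `[1%R, +oo[) (t^-1)%:E)%E.
Proof.
have [hC1 _ _] := hphi; split; last exact: Hausdorff_opnormE.
split; first exact: Hausdorff_bounded_necessary.
by move=> [mu01 mufin]; exact: Hausdorff_bounded_sufficient.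
Qed.
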